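(* Let $n\ge 3$ be odd and let $G$ be a connected well-covered unicyclic graph of order $n$. If $n\le 7$, then $C_n\preceq G$. If $n\ge 9$ and $H_n$ is a graph of order $n$ in $\mathcal{S}_P$, then $H_n\preceq G$.
   Context: All graphs are finite, simple and undirected. A graph is well-covered if all of its maximal independent sets have the same size. A connected unicyclic graph is a connected graph containing exactly one cycle. The independence polynomial of a graph $G$ is $I(G,x)=\sum_{k\ge 0} i_kx^k$, where $i_k$ is the number of independent sets of size $k$ in $G$. It is known that the root of $I(G,x)$ of smallest modulus is real and lies in $[-1,0)$; it is denoted $\xi(G)$ (equivalently, the largest real root of $I(G,x)$). For graphs $G,H$, write $H\preceq G$ if and only if $I(H,x)\ge I(G,x)$ for all $x\in[\xi(G),0]$. $C_n$ is the cycle and $P_n$ the path on $n$ vertices. For a graph $G$, the graph star $G^{\ast}$ is obtained from $G$ by attaching, for each vertex $v$ of $G$, a new vertex $v^{\ast}$ joined by an edge to $v$ only. For $g\in\{3,5\}$ and integers $k,\ell\ge 0$ with $k>0$ or $\ell>0$, $G(g,k,\ell)$ is the graph obtained from a cycle with vertices $c_1,c_2,\dots,c_g$ in cyclic order as follows: if $k>0$, take a disjoint copy of $P_k^{\ast}$ and join $c_1$ by an edge to an end vertex of the path $P_k$ (so for $k\ge2$ this unique neighbour of $c_1$ in $P_k^{\ast}$ has degree $3$); if $\ell>0$, take a disjoint copy of $P_\ell^{\ast}$ and join $c_3$ by an edge to an end vertex of the path $P_\ell$. $\mathcal{S}_P$ is the set of all graphs $G(g,k,\ell)$ for all such $g,k,\ell$.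 *)

(* Defs.v *)
From HB Require Import structures.
From mathcomp Require Import all_boot all_order all_algebra.
From mathcomp Require Import complex.
From mathcomp Require Import all_classical all_reals.

Set Implicit Arguments.
Unset Strict Implicit.
Unset Printing Implicit Defensive.

Import Order.TTheory GRing.Theory Num.Theory.

Local Open Scope ring_scope.
Local Open Scope complex_scope.

Record sgraph := SGraph {
  vertex :> finType;
  edge : rel vertex;
  edge_sym : symmetric edge;
  edge_irrefl : irreflexive edge
}.

Section GraphOf.
Variables (T : finType) (r : rel T).

Definition sym_irrefl_closure : rel T := fun u v => (u != v) && (r u v || r v u).

Lemma sym_irrefl_closure_sym : symmetric sym_irrefl_closure.
Proof. by move=> u v; rewrite /sym_irrefl_closure eq_sym orbC. Qed.

Lemma sym_irrefl_closure_irrefl : irreflexive sym_irrefl_closure.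
Proof. by move=> u; rewrite /sym_irrefl_closure eqxx. Qed.

(* The graph whose edges are the pairs {u, v} of distinct vertices with r u v
   or r v u; in the constructions below r lists each edge in one direction. *)
Definition graph_of : sgraph :=
  SGraph sym_irrefl_closure_sym sym_irrefl_closure_irrefl.
End GraphOf.

Definition graph_iso (G H : sgraph) : Prop :=
  exists f : G -> H, bijective f /\ forall u v, edge (f u) (f v) = edge u v.

Section GraphNotions.
Variable G : sgraph.

Definition independent (S : {set G}) : bool :=
  [forall u in S, forall v in S, ~~ edge u v].

Definition well_covered : Prop :=
  forall S1 S2 : {set G},
    maxset independent S1 -> maxset independent S2 -> #|S1| = #|S2|.

Definition graph_connected : Prop :=
  (0 < #|G|)%N /\ forall u v : G, connect (@edge G) u v.

Definition is_cycle (c : seq G) : Prop :=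
  ucycle (@edge G) c /\ (3 <= size c)%N.

Definition cycle_edges (c : seq G) : {set {set G}} :=
  [set [set u; next c u] | u in c].

(* A cycle is a subgraph, so vertex sequences that differ by a rotation or a
   reversal are the same cycle; they are identified through their edge sets. *)
Definition unicyclic : Prop :=
  exists c : seq G, is_cycle c /\
    forall d : seq G, is_cycle d -> cycle_edges d = cycle_edges c.

Definition num_independent (k : nat) : nat :=
  #|[set S : {set G} | independent S & #|S| == k]|.

Definition independence_poly (R : nzRingType) : {poly R} :=
  \poly_(k < #|G|.+1) (num_independent k)%:R.

End GraphNotions.

Definition is_smallest_modulus_root (R : realType) (G : sgraph) (x : R) : Prop :=
  root (independence_poly G R[i]) x%:C /\
  forall z : R[i], root (independence_poly G R[i]) z -> `|x%:C| <= `|z|.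

(* For every graph with at least one vertex, the complex root of smallest
   modulus of the independence polynomial exists, is unique and is real; the
   default value 0 is thus used for the empty graph only. *)
Definition xi (R : realType) (G : sgraph) : R :=
  xget 0 [set x : R | is_smallest_modulus_root G x]%classic.

Definition preceq (R : realType) (H G : sgraph) : Prop :=
  forall x : R, xi R G <= x <= 0 ->
    (independence_poly G R).[x] <= (independence_poly H R).[x].

Definition cycle_graph (n : nat) : sgraph :=
  graph_of (fun i j : 'I_n => j == ordS i).

Definition path_graph (n : nat) : sgraph :=
  graph_of (fun i j : 'I_n => j == i.+1 :> nat).

(* inl v is the vertex v of G and inr v is the pendant vertex v^*. *)
Definition graph_star (G : sgraph) : sgraph :=
  graph_of (fun u v : G + G =>
    match u, v with
    | inl x, inl y => edge x y
    | inl x, inr y => x == y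
    | _, _ => false
    end).

(* Vertex i of the cycle is c_(i+1); vertex 0 of each path is the end joined to
   the cycle.  When k = 0 or l = 0 the corresponding summand is empty. *)
Definition GP (g k l : nat) : sgraph :=
  graph_of (fun u v : cycle_graph g +
                      (graph_star (path_graph k) + graph_star (path_graph l)) =>
    match u, v with
    | inl c, inl d => edge c d
    | inr (inl p), inr (inl q) => edge p q
    | inr (inr p), inr (inr q) => edge p q
    | inl c, inr (inl (inl i)) =>
        (nat_of_ord c == 0%N) && (nat_of_ord i == 0%N)
    | inl c, inr (inr (inl i)) =>
        (nat_of_ord c == 2%N) && (nat_of_ord i == 0%N)
    | _, _ => false
    end).

Definition in_SP (H : sgraph) : Prop :=
  exists g k l : nat,
    [/\ g = 3%N \/ g = 5%N, (0 < k)%N \/ (0 < l)%N & graph_iso H (GP g k l)].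

(* Main.v *)
(** The smallest-modulus root enters only through the fact that [I(G, .)] has no
    zero in [(xi(G), 0]]; there all induced subgraphs of [G] have positive
    values, and the endpoint is reached by continuity.

    Repeatedly removing leaf-support pairs shows that a connected well-covered
    unicyclic graph [G] of odd order [2e+1] is [C_7], or consists of a triangle
    or a pentagon and of pairs (support, leaf), where at most two vertices of the
    triangle, respectively at most two nonadjacent vertices of the pentagon,
    are joined to supports. Summing out the leaves and the free cycle vertices gives
    [I(G, x) = (1 + x)^e I(F, x / (1 + x))] for a connected induced subgraph
    [F] on [e + 1] vertices. For the members of S_P this [F] is a path, and
    among connected graphs of given order the path has the largest
    independence polynomial wherever the graph and its induced subgraphs have
    positive values. For [n <= 7] the resulting polynomial
    is compared with that of [C_n] directly. *)

Require Import Defs.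
From mathcomp Require Import all_boot all_order all_algebra.
From mathcomp Require Import all_reals.
From mathcomp Require classical_sets.
From mathcomp Require Import complex polyrcf ring lra zify.

Set Implicit Arguments.
Unset Strict Implicit.
Unset Printing Implicit Defensive.

Import Order.TTheory GRing.Theory Num.Theory.

Local Open Scope ring_scope.

(** The bound of [ip F] by the path value does not follow by induction on itself: the deletion
    recurrence multiplies the term of [F :\: cN r] by a nonpositive number, so an upper bound would
    call for a lower bound there. This is why [conn_pathv_pos] controls a ratio at every root [r],
    together with the positivity of the path values. On the structural side, the perfect matching of
    the vertices off the cycle makes maximal independent sets rigid: each takes exactly one vertex
    of every matched pair and the same number [k] of cycle vertices. Every restriction on leaves and
    attachments comes from this, by building an independent set whose extensions would miss a pair
    or take fewer than [k] cycle vertices. *)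

(** * Independence polynomials of induced subgraphs *)

Section Independence.
Variable G : sgraph.
Implicit Types (A B S : {set G}) (u v w : G).

Lemma edgeC u v : edge u v = edge v u.
Proof. exact: edge_sym. Qed.

Lemma edgexx u : edge u u = false.
Proof. exact: edge_irrefl. Qed.

Lemma indP S : reflect {in S &, forall u v, ~~ edge u v} (independent S).
Proof.
apply: (iffP 'forall_in_forall_inP) => h; first by move=> u v uS vS; apply: h.
by move=> u uS v vS; apply: h.
Qed.

Lemma ind_sub A B : A \subset B -> independent B -> independent A.
Proof.
by move=> /subsetP sAB /indP iB; apply/indP => u v /sAB uB /sAB; apply: iB.
Qed.

Lemma ind0 : independent (set0 : {set G}).
Proof. by apply/indP => u v; rewrite inE. Qed.

Definition cN v : {set G} := [set u | (u == v) || edge v u].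

Lemma ind_setU1 v S :
  independent (v |: S) = independent S && [forall u in S, ~~ edge v u].
Proof.
apply/indP/andP => [h|[/indP iS /forall_inP nv] x y].
  split; first by apply/indP => x y xS yS; apply: h; rewrite !inE ?xS ?yS orbT.
  by apply/forall_inP => u uS; apply: h; rewrite !inE ?eqxx ?uS ?orbT.
rewrite !inE => /predU1P[->|xS] /predU1P[->|yS].
- by rewrite edgexx.
- exact: nv.
- by rewrite edgeC nv.
- exact: iS.
Qed.

Section Poly.
Variable R : comNzRingType.

(** An induced subgraph is a vertex set of the ambient graph, so that deletion is a set difference
    and stays in one type. The ring varies: real and complex values are needed, and ['X] gives the
    polynomial itself. *)
Definition ip A (x : R) : R :=
  \sum_(S : {set G} | (S \subset A) && independent S) x ^+ #|S|.

Lemma ip0 x : ip set0 x = 1.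
Proof.
rewrite /ip (big_pred1 set0) ?cards0 ?expr0 // => S.
by rewrite subset0 /=; case: eqP => //= ->; rewrite ind0.
Qed.

Lemma ip_del A v x : v \in A -> ip A x = ip (A :\ v) x + x * ip (A :\: cN v) x.
Proof.
move=> vA; rewrite /ip (bigID (fun S : {set G} => v \in S)) /= addrC.
congr (_ + _).
  by apply: eq_bigl => S; rewrite subsetD1 andbAC.
rewrite big_distrr /=.
rewrite (reindex_onto (fun S => v |: S) (fun S => S :\ v)) /=; last first.
  by move=> S /andP[_ vS]; rewrite setD1K.
apply: eq_big => [S|S].
  rewrite setU11 andbT ind_setU1 subUset sub1set vA /=.
  apply/andP/andP => [[/and3P[SA iS /forall_inP nv] /eqP e]|[SA iS]].
    split=> //; apply/subsetP => u uS; rewrite !inE (subsetP SA) // andbT.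
    rewrite negb_or nv // andbT; apply: contraTneq uS => ->.
    by rewrite -e !inE eqxx.
  have vS : v \notin S.
    by apply/negP => /(subsetP SA); rewrite !inE eqxx.
  split; last by rewrite setU1K.
  rewrite iS (subset_trans SA (subsetDl _ _)) /=.
  apply/forall_inP => u /(subsetP SA); rewrite !inE negb_or.
  by case/andP=> /andP[].
move=> /andP[/andP[_ _]] /eqP e.
have vS : v \notin S by rewrite -e !inE eqxx.
by rewrite cardsU1 vS exprS.
Qed.

Lemma ip_disj A B x : {in A & B, forall u v, (u != v) && ~~ edge u v} ->
  ip (A :|: B) x = ip A x * ip B x.
Proof.
have [n] := ubnP #|B|; elim: n B => // n IH B ltBn nAB.
have [->|[v vB]] := set_0Vmem B; first by rewrite setU0 ip0 mulr1.
have ltB : (#|B :\ v| < n)%N by rewrite (cardsD1 v B) vB in ltBn *.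
rewrite (ip_del (v := v)); last by rewrite !inE vB orbT.
have -> : (A :|: B) :\ v = A :|: (B :\ v).
  apply/setP => z; rewrite !inE; case: (z \in A) (nAB z v) => // /(_ isT vB).
  by case/andP => ->.
have -> : (A :|: B) :\: cN v = A :|: (B :\: cN v).
  apply/setP => z; rewrite !inE; case: (z \in A) (nAB z v) => // /(_ isT vB).
  by case/andP => /negPf-> /negPf; rewrite edgeC => ->.
rewrite (ip_del x vB) !IH //; first by ring.
- apply: leq_ltn_trans ltB; apply: subset_leq_card; apply: setDS.
  by rewrite sub1set inE eqxx.
- by move=> a b aA; rewrite inE => /andP[_ bB]; apply: nAB.
- by move=> a b aA; rewrite inE => /andP[_ bB]; apply: nAB.
Qed.

Lemma ip1 v x : ip [set v] x = 1 + x.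
Proof.
rewrite (ip_del (v := v)) ?inE // setDv ip0.
suff -> : [set v] :\: cN v = set0 by rewrite ip0 mulr1.
by apply/setP => z; rewrite !inE; case: eqP; rewrite ?andbF.
Qed.

End Poly.

Section Order.
Variable R : realFieldType.
Implicit Types x y : R.

Definition hpos A x := forall B, B \subset A -> 0 < ip B x.

Lemma hpos_sub A B x : A \subset B -> hpos B x -> hpos A x.
Proof. by move=> sAB h C sCA; apply: h; apply: subset_trans sAB. Qed.

(** Restoring a deleted vertex adds [x] times a positive value, which is nonpositive. *)
Lemma ip_le A B x : x <= 0 -> B \subset A -> hpos A x -> ip A x <= ip B x.
Proof.
move=> x0; have [n] := ubnP #|A|; elim: n A => // n IH A ltAn sBA pA.
have [->//|neq] := eqVneq B A.
have /subsetPn[v vA vB] : ~~ (A \subset B).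
  by apply: contra neq => sAB; rewrite eqEsubset sBA.
have ltA : (#|A :\ v| < n)%N by rewrite (cardsD1 v A) vA in ltAn *.
have sBv : B \subset A :\ v by rewrite subsetD1 sBA.
apply: le_trans (IH _ ltA sBv (hpos_sub (subsetDl _ _) pA)).
rewrite (ip_del x vA) gerDl mulr_le0_ge0 // ltW // pA // subsetDl //.
Qed.

End Order.
End Independence.

(* Value at [y] of the independence polynomial of the path on [j.-1] vertices;
   the shift makes the recurrence valid from [j = 0] on. *)
Fixpoint pathv (R : nzRingType) (y : R) (j : nat) : R :=
  match j with
  | 0 => 1
  | j'.+1 => match j' with 0 => 1 | i.+1 => pathv y j' + y * pathv y i end
  end.

Lemma pathvSS (R : nzRingType) (y : R) j :
  pathv y j.+2 = pathv y j.+1 + y * pathv y j.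
Proof. by []. Qed.

(** In the path on [a + b + 1] vertices, this is deletion of the vertex with [a] vertices on one
    side and [b] on the other; [pathv y 0 = 1] covers the ends. *)
Lemma pathv_add (R : comNzRingType) (y : R) a b :
  pathv y (a + b).+2 = pathv y a.+1 * pathv y b.+1 + y * (pathv y a * pathv y b).
Proof.
elim/ltn_ind: a => -[|[|a]] IH.
- by rewrite add0n pathvSS /=; ring.
- by rewrite add1n !pathvSS /=; ring.
- rewrite !addSn pathvSS -addSn IH // (IH a) // !(pathvSS _ a).
  rewrite (pathvSS _ a.+1) pathvSS; ring.
Qed.

Section Ratio.
Variable R : realFieldType.
Implicit Type y : R.

(* For [u > 0] the right side minus the left side is
   [- y * pathv y u.-1 * pathv y k.-1 * pathv y (u + k).+2], and the last factor is the
   expression assumed nonnegative, by [pathv_add]. *)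
Lemma pathv_ratio y u k : y <= 0 ->
  (forall j, (j <= maxn u k.+1)%N -> 0 < pathv y j) ->
  0 <= pathv y u.+1 * pathv y k.+1 + y * (pathv y u * pathv y k) ->
  (0 < k)%N ->
  pathv y u.+1 * pathv y k.+1 * pathv y (u + k) <=
  pathv y (u + k).+1 * (pathv y u * pathv y k).
Proof.
move=> y0 pos h k0; case: u k k0 pos h => [|u] [//|k] _ pos h.
  by rewrite add0n /=; lra.
rewrite addSn addnS; have -> := pathv_add y u k.
have -> : pathv y (u + k).+3 = pathv y u.+2 * pathv y k.+1 + y * (pathv y u.+1 * pathv y k).
  by rewrite -addSn pathv_add.
have pu : 0 < pathv y u by apply: pos; lia.
have pk : 0 < pathv y k by apply: pos; lia.
move: h; rewrite !pathvSS.
move: (pathv y u) (pathv y u.+1) (pathv y k) (pathv y k.+1) pu pk => a b c d pa pc h.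
rewrite -subr_ge0.
set rhs := (X in 0 <= X).
have -> : rhs = (- y) * (a * c) * ((b + y * a) * (d + y * c) + y * (b * d)).
  by rewrite /rhs; ring.
apply: mulr_ge0 => //; apply: mulr_ge0; last exact: ltW (mulr_gt0 _ _).
by rewrite oppr_ge0.
Qed.
End Ratio.

(** * Connected induced subgraphs *)

Section Connected.
Variable G : sgraph.
Implicit Types (A B S F K : {set G}) (u v w r : G).

(* Connectedness of the induced subgraph on [A], by cuts. *)
Definition conn A := forall B, B \subset A -> B != set0 -> B != A ->
  exists u v, [/\ u \in B, v \in A :\: B & edge u v].

Lemma conn_set1 v : conn [set v].
Proof. by move=> B; rewrite subset1 => /orP[]/eqP->; rewrite eqxx. Qed.

Lemma conn_out F S : conn F -> S \subset F -> S != set0 -> S != F ->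
  exists2 w, w \in F :\: S & exists2 u, u \in S & edge u w.
Proof. by move=> cF SF S0 SnF; have [u [w [uS wF e]]] := cF S SF S0 SnF; exists w => //; exists u. Qed.

Lemma conn_setU1 S u w : conn S -> u \in S -> edge u w -> conn (w |: S).
Proof.
move=> cS uS e B sB B0 BnS.
have [wS|wS] := boolP (w \in S).
  have eS : w |: S = S by apply/setUidPr; rewrite sub1set.
  by rewrite eS in sB BnS *; apply: cS.
have [BS0|BS0] := eqVneq (B :&: S) set0.
  have Bw : B = [set w].
    apply/eqP; have : B \subset [set w].
      apply/subsetP => z zB; have := subsetP sB z zB; rewrite !inE => /orP[//|zS].
      by move/setP/(_ z): BS0; rewrite !inE zB zS.
    by rewrite subset1 (negPf B0) orbF.
  exists w, u; rewrite Bw !inE eqxx uS orbT edgeC e; split=> //.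
  by rewrite andbT; apply: contraNneq wS => <-.
have [BSS|BSS] := eqVneq (B :&: S) S.
  have sSB : S \subset B by apply/setIidPr.
  have wB : w \notin B.
    apply: contra BnS => wB; rewrite eqEsubset sB subUset sub1set wB //.
  by exists u, w; rewrite (subsetP sSB) // !inE wB eqxx e.
have [a [b [aB bS e']]] := cS _ (subsetIr _ _) BS0 BSS.
exists a, b; move: aB bS; rewrite !inE => /andP[-> aS] /andP[h bS]; split=> //.
by rewrite bS orbT andbT; move: h; rewrite bS andbT.
Qed.

(** Adding adjacent vertices one at a time must stop. With [P] confining the set to a part of [F],
    this yields both noncut vertices and components. *)
Lemma conn_maximal (P : pred {set G}) S0 : S0 != set0 -> conn S0 -> P S0 ->
  exists S, [/\ S0 \subset S, conn S, P S &
    forall u w, u \in S -> w \notin S -> edge u w -> ~~ P (w |: S)].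
Proof.
move=> n0 c0 p0.
have [n] := ubnP (#|G| - #|S0|); elim: n S0 n0 c0 p0 => // n IH S0 n0 c0 p0 ltn.
case: (boolP [exists u in S0, exists w, [&& w \notin S0, edge u w & P (w |: S0)]]).
  case/exists_inP => u uS /existsP[w /and3P[wS e pw]].
  have [||||S [h1 h2 h3 h4]] := IH (w |: S0).
  - by apply/set0Pn; exists w; rewrite setU11.
  - exact: conn_setU1 e.
  - by [].
  - have := max_card (mem (w |: S0)); rewrite cardsU1 wS; lia.
  exists S; split=> //; apply: subset_trans h1; exact: subsetUr.
rewrite negb_exists_in => /forall_inP h; exists S0; split=> // u w uS wS e.
have := h u uS; rewrite negb_exists => /forallP/(_ w).
by rewrite wS e.
Qed.

(** A connected proper subset of [F] that cannot be extended misses exactly one vertex, since adding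
    an adjacent vertex has to give all of [F]. *)
Lemma conn_noncut F S : conn F -> conn S -> S != set0 -> S \proper F ->
  exists w, [/\ w \in F, w \notin S & conn (F :\ w)].
Proof.
move=> cF cS n0 pS.
have [T [sST cT pT hT]] := conn_maximal (P := fun T => T \proper F) n0 cS pS.
have TF : T \subset F by apply: proper_sub.
have T0 : T != set0.
  by apply: contraNneq n0 => e; move: sST; rewrite e subset0.
have TnF : T != F by move: pT; rewrite properEneq => /andP[].
have [w] := conn_out cF TF T0 TnF; rewrite inE => /andP[wT wF] [u uT e].
exists w; split=> //; first by apply: contra wT; apply: (subsetP sST).
have := hT u w uT wT e; rewrite properEneq subUset sub1set wF TF !andbT.
by move=> /negPn/eqP <-; rewrite setU1K.
Qed.

(** [K] is the component of [F :\ r] that contains some neighbour [v] of [r], and [F'] is everything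
    else, [r] included. *)
Lemma conn_split F r : conn F -> r \in F -> F != [set r] ->
  exists F' K v, [/\ F = F' :|: K, [disjoint F' & K] & r \in F'] /\
    [/\ conn F', conn K, v \in K, edge r v &
     {in F' :\ r & K, forall a b, ~~ edge a b}].
Proof.
move=> cF rF Fr.
have [v] := conn_out cF (S := [set r]) ltac:(by rewrite sub1set)
   ltac:(by apply/set0Pn; exists r; rewrite inE) ltac:(by rewrite eq_sym).
rewrite !inE => /andP[vr vF] [_ /set1P-> erv].
have [||K [vK cK KF hK]] := @conn_maximal (fun K : {set G} => K \subset F :\ r) [set v] _ (@conn_set1 v).
- by apply/set0Pn; exists v; rewrite inE.
- by rewrite sub1set !inE vr.
have {}vK : v \in K by apply: (subsetP vK); rewrite inE.
have rK : r \notin K by apply/negP => /(subsetP KF); rewrite !inE eqxx.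
have sKF : K \subset F by apply: subset_trans KF (subsetDl _ _).
have noe : {in (F :\: K) :\ r & K, forall a b, ~~ edge a b}.
  move=> a b; rewrite !inE => /and3P[ar aK aF] bK; apply/negP => e.
  have := hK b a bK aK; rewrite edgeC e subUset sub1set KF !inE ar aF.
  by move/(_ isT).
exists (F :\: K), K, v; split; split=> //.
- apply/setP => z; rewrite !inE.
  by case: (boolP (z \in K)) => zK; rewrite ?orbT ?orbF // (subsetP sKF).
- by apply/pred0P => z /=; rewrite !inE; case: (z \in K); rewrite ?andbF.
- by rewrite inE rK.
(* Connectedness of [F'] for cuts avoiding [r]: an edge leaves [B] inside [F], and it cannot end in
   [K]. A cut containing [r] is replaced by its complement. *)
have half B : B \subset F :\: K -> B != set0 -> r \notin B ->
  exists u w, [/\ u \in B, w \in (F :\: K) :\: B & edge u w].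
  move=> sB B0 rB.
  have [|||u [w [uB wF e]]] := cF B.
  - exact: subset_trans sB (subsetDl _ _).
  - exact: B0.
  - by apply: contraNneq rB => ->.
  exists u, w; split=> //; move: wF; rewrite !inE => /andP[-> wF].
  rewrite wF andbT; apply/negP => wK.
  have := noe u w; rewrite e !inE wK => /(_ _ isT).
  have := subsetP sB u uB; rewrite !inE => ->.
  by rewrite andbT => /implyP; rewrite implybF negbK => /eqP ur; rewrite -ur uB in rB.
move=> B sB B0 Bn.
have [rB|rB] := boolP (r \in B); last exact: half.
have [|||u [w [uB wF e]]] := half ((F :\: K) :\: B).
- exact: subsetDl.
- by rewrite setD_eq0; apply: contra Bn => s; rewrite eqEsubset sB.
- by rewrite inE rB.
exists w, u; split=> //; last by rewrite edgeC.
by move: wF; rewrite !inE; case: (w \in B) => //=; case: (w \in K) => //=; case: (w \in F).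
Qed.

End Connected.

(** * Comparison of connected graphs with paths *)

Section PathMaximal.
Variables (R : realFieldType) (G : sgraph).
Implicit Types (A B S F K : {set G}) (u v w r : G).

(* [ip (F :\ r) / ip (F :\: cN r)], which governs [ip F / ip (F :\ r)], is largest
   for the path rooted at an end: a component of [F :\ r] and the rest of [F] at [r] are
   compared with paths by induction and merged with [pathv_ratio]. *)
Lemma conn_pathv_pos (y : R) F : y <= 0 -> conn F -> F != set0 -> hpos F y ->
  (forall j, (j <= #|F|.+1)%N -> 0 < pathv y j) /\
  forall r, r \in F ->
    ip (F :\ r) y * pathv y #|F|.-1 <= ip (F :\: cN r) y * pathv y #|F|.
Proof.
move=> y0; have [n] := ubnP #|F|; elim: n F => // n IH F ltn cF F0 pF.
have delta r : r \in F -> ip F y = ip (F :\ r) y + y * ip (F :\: cN r) y.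
  by move=> rF; apply: ip_del.
have [/eqP/cards1P[r0 eF]|F1] := eqVneq #|F| 1%N.
  split.
    move=> j; rewrite eF cards1; case: j => [|[|[|j]]] //= _; rewrite ?ltr01 //.
    by have := pF F (subxx _); rewrite eF ip1 mulr1.
  move=> r; rewrite eF inE => /eqP->; rewrite cards1 /= !mulr1.
  have -> : [set r0] :\: cN r0 = set0.
    by apply/setP => z; rewrite !inE; case: eqP; rewrite ?andbF.
  by rewrite setDv ip0.
have F2 : (1 < #|F|)%N by rewrite ltn_neqAle eq_sym F1 card_gt0.
(* Deleting a noncut vertex gives the path values up to index [#|F|]; the last one needs the ratio
   for [F] itself. *)
have posF j : (j <= #|F|)%N -> 0 < pathv y j.
  have [r rF] := set0Pn _ F0.
  have rF1 : [set r] \proper F by rewrite properEcard sub1set rF cards1.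
  have r0 : [set r] != set0 by apply/set0Pn; exists r; rewrite inE.
  have [w [wF _ cw]] := conn_noncut cF (@conn_set1 G r) r0 rF1.
  have cardFw : #|F| = #|F :\ w|.+1 by rewrite (cardsD1 w F) wF.
  have ltw : (#|F :\ w| < n)%N by rewrite -ltnS -cardFw.
  have Fw0 : F :\ w != set0 by rewrite -card_gt0 -ltnS -cardFw.
  have [posw _] := IH _ ltw cw Fw0 (hpos_sub (subsetDl _ _) pF).
  by rewrite cardFw => /posw.
have ratio r : r \in F ->
    ip (F :\ r) y * pathv y #|F|.-1 <= ip (F :\: cN r) y * pathv y #|F|.
  move=> rF.
  have Fr : F != [set r] by apply: contraNneq F1 => ->; rewrite cards1.
  have [F' [K [v [[eF dFK rF'] [cF' cK vK erv noe]]]]] := conn_split cF rF Fr.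
  have cardF : #|F| = (#|F'| + #|K|)%N by rewrite eF cardsU disjoint_setI0 // cards0 subn0.
  have k0 : (0 < #|K|)%N by apply/card_gt0P; exists v.
  have f0 : (0 < #|F'|)%N by apply/card_gt0P; exists r.
  have sF'F : F' \subset F by rewrite eF subsetUl.
  have sKF : K \subset F by rewrite eF subsetUr.
  have rK : r \notin K by apply: contraL rF' => /(disjointFl dFK)->.
  have ltF' : (#|F'| < n)%N by clear - ltn cardF k0; lia.
  have ltK : (#|K| < n)%N by clear - ltn cardF f0; lia.
  have F'0 : F' != set0 by rewrite -card_gt0.
  have K0 : K != set0 by rewrite -card_gt0.
  have [posF' ratF'] := IH F' ltF' cF' F'0 (hpos_sub sF'F pF).
  have [posK ratK] := IH K ltK cK K0 (hpos_sub sKF pF).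
  have {ratF'} := ratF' r rF'; have {ratK} := ratK v vK.
  have ea : ip (F :\ r) y = ip (F' :\ r) y * ip K y.
    rewrite -ip_disj => [|a b aF' bK].
      by congr ip; rewrite eF setDUl; congr (_ :|: _); apply/setDidPl; rewrite disjoint_sym disjoints1.
    rewrite noe // andbT; apply: contraTneq aF' => ->.
    by rewrite inE (disjointFl dFK bK) andbF.
  have eb : ip (F :\: cN r) y = ip (F' :\: cN r) y * ip (K :\: cN r) y.
    rewrite -ip_disj => [|a b]; first by rewrite eF setDUl.
    rewrite !inE negb_or => /andP[/andP[ar _] aF'] /andP[_ bK].
    rewrite noe ?inE ?ar // andbT; apply: contraTneq aF' => ->.
    by rewrite (disjointFl dFK bK).
  (* [K :\: cN r] omits [v], hence lies in [K :\ v]. It may be smaller, as [r] can have further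
     neighbours in [K]. *)
  have lb : ip (K :\ v) y <= ip (K :\: cN r) y.
    apply: ip_le => //; last by apply: hpos_sub pF; apply: subset_trans (subsetDl _ _) sKF.
    apply/subsetP => z; rewrite !inE => /andP[nz zK]; rewrite zK !andbT.
    by apply: contraNneq nz => ->; rewrite erv orbT.
  have dK := ip_del y vK.
  have pos A : A \subset F -> 0 < ip A y by apply: pF.
  have pIF : 0 < ip F y by apply: pos.
  have pa' : 0 < ip (F' :\ r) y by apply: pos; apply: subset_trans (subsetDl _ _) sF'F.
  have pb' : 0 < ip (F' :\: cN r) y by apply: pos; apply: subset_trans (subsetDl _ _) sF'F.
  have pIK : 0 < ip K y by apply: pos.
  have pIKv : 0 < ip (K :\ v) y by apply: pos; apply: subset_trans (subsetDl _ _) sKF.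
  have pIKr : 0 < ip (K :\: cN r) y by apply: pos; apply: subset_trans (subsetDl _ _) sKF.
  move: (delta r rF); rewrite ea eb; move: dK.
  move: #|F'| #|K| cardF k0 f0 posF' posK {ltF' ltK} => f k cardF k0 f0 posF' posK.
  rewrite cardF.
  case: f f0 posF' cardF => // u _ posF'; case: k k0 posK => // k _ posK cardF.
  rewrite !addSn !addnS !succnK.
  move: (ip K y) (ip (K :\ v) y) (ip (K :\: cN v) y) pIK pIKv lb pIKr pIF.
  move: (ip (K :\: cN r) y) (ip (F' :\ r) y) (ip (F' :\: cN r) y) (ip F y) pa' pb'.
  move=> bK a' b' iF pa' pb' iK aK cK' pIK pIKv lb pIKr pIF dK dF rK' rF''.
  have kpos j : (j <= k.+2)%N -> 0 < pathv y j by apply: posK.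
  have upos j : (j <= u.+2)%N -> 0 < pathv y j by apply: posF'.
  have pk := kpos k.+1 (leqnSn _); have pk2 := kpos k.+2 (leqnn _).
  have pu := upos u (leq_trans (leqnSn _) (leqnSn _)).
  have pu1 := upos u.+1 (leqnSn _).
  have rK2 : iK * pathv y k.+1 <= aK * pathv y k.+2.
    rewrite dK pathvSS mulrDl mulrDr lerD2l.
    by rewrite -mulrA [leRHS]mulrCA ler_wnM2l.
  set U := pathv y u in pu rF'' *; set U1 := pathv y u.+1 in pu1 rF'' *.
  (* Product of the ratio for [F'] at [r] with [rK2], the ratio for [K] at [v], the latter loosened
     by [lb]. *)
  have main : (a' * iK) * (U * pathv y k.+1) <= (b' * bK) * (U1 * pathv y k.+2).
    rewrite mulrACA [leRHS]mulrACA; apply: ler_pM => //.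
    - by rewrite mulr_ge0 // ltW.
    - by rewrite mulr_ge0 // ltW.
    - apply: le_trans rK2 _; rewrite ler_wpM2r // ltW //.
  have pUk : 0 < U * pathv y k.+1 by rewrite mulr_gt0.
  have pB : 0 < b' * bK by rewrite mulr_gt0.
  (* The hypothesis of [pathv_ratio] is inherited from [0 < ip F y]: by [main],
     [iF * (U * pathv y k.+1)] is at most [b' * bK] times the wanted expression. *)
  have cond : 0 <= U1 * pathv y k.+2 + y * (U * pathv y k.+1).
    rewrite -(pmulr_rge0 _ pB) mulrDr.
    apply: le_trans (_ : iF * (U * pathv y k.+1) <= _).
      by rewrite mulr_ge0 // ltW.
    by rewrite dF mulrDl lerD //; rewrite -mulrA mulrCA.
  have hmax j : (j <= maxn u k.+2)%N -> 0 < pathv y j.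
    rewrite leq_max => /orP[h|h]; [apply: upos|exact: kpos].
    exact: leq_trans h (leq_trans (leqnSn _) (leqnSn _)).
  have := pathv_ratio y0 hmax cond isT; rewrite -/U -/U1 => fin.
  rewrite addnS in fin.
  have {}fin : (b' * bK) * (U1 * pathv y k.+2 * pathv y (u + k).+1) <=
     (b' * bK) * (pathv y (u + k).+2 * (U * pathv y k.+1)) by rewrite ler_wpM2l // ltW.
  have pP : 0 < pathv y (u + k).+1.
    by apply: posF; rewrite cardF !addSn ?addnS.
  rewrite -(ler_pM2r pUk).
  apply: le_trans (_ : (b' * bK) * (U1 * pathv y k.+2) * pathv y (u + k).+1 <= _).
    by rewrite [leLHS]mulrAC ler_wpM2r // ltW.
  by rewrite -[leLHS]mulrA -[leRHS]mulrA.
split=> // j; rewrite leq_eqVlt => /orP[/eqP->|]; last exact: posF.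
(* The ratio gives [ip F y * pathv y #|F| <= ip (F :\ r) y * pathv y #|F|.+1], and the left side is
   positive. *)
have [r rF] := set0Pn _ F0.
have pFr : 0 < ip (F :\ r) y by apply: pF; apply: subsetDl.
rewrite -(pmulr_rgt0 _ pFr).
have := ratio r rF; have := delta r rF; have := posF _ (leqnn _).
have := pF F (subxx _).
case: #|F| F2 => // f _ pIF pf dF rat.
apply: lt_le_trans (_ : ip F y * pathv y f.+1 <= _); first exact: mulr_gt0.
rewrite dF mulrDl [pathv y f.+2]pathvSS mulrDr lerD2l.
by rewrite -mulrA [leRHS]mulrCA ler_wnM2l.
Qed.

(** For a noncut vertex [w], the ratio bounds [ip F / ip (F :\ w)] by the quotient of consecutive
    path values, and [ip (F :\ w)] is bounded by induction. *)
Lemma conn_ip_le_pathv (y : R) F : y <= 0 -> conn F -> F != set0 -> hpos F y ->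
  ip F y <= pathv y #|F|.+1.
Proof.
move=> y0; have [n] := ubnP #|F|; elim: n F => // n IH F ltn cF F0 pF.
have [r rF] := set0Pn _ F0.
have [w [wF cw]] : exists w, w \in F /\ (F :\ w = set0 \/ F :\ w != set0 /\ conn (F :\ w)).
  have [eF|nF] := eqVneq F [set r].
    by exists r; split=> //; left; rewrite eF setDv.
  have rF1 : [set r] \proper F by rewrite properEneq sub1set rF eq_sym nF.
  have r0 : [set r] != set0 by apply/set0Pn; exists r; rewrite inE.
  have [w [wF wr cw]] := conn_noncut cF (@conn_set1 G r) r0 rF1.
  exists w; split=> //; right; split=> //; apply/set0Pn; exists r.
  by rewrite !inE rF andbT; apply: contraNneq wr => ->; rewrite inE.
have cardFw : #|F| = #|F :\ w|.+1 by rewrite (cardsD1 w F) wF.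
have [pos rat] := conn_pathv_pos y0 cF F0 pF.
have pf := pos _ (leqnSn _); have pf1 := pos _ (leqnn _).
have h : ip (F :\ w) y <= pathv y #|F|.
  case: cw => [e|[Fw0 cw]].
    by rewrite cardFw e ip0 cards0.
  rewrite cardFw; apply: IH => //; first by rewrite -ltnS -cardFw.
  exact: hpos_sub (subsetDl _ _) pF.
rewrite -(ler_pM2r pf).
apply: le_trans (_ : ip (F :\ w) y * pathv y #|F|.+1 <= _); last first.
  by rewrite mulrC ler_wpM2l // ltW.
have := rat w wF; rewrite (ip_del y wF) cardFw succnK => {}rat.
rewrite mulrDl pathvSS mulrDr lerD2l.
by rewrite -mulrA [leRHS]mulrCA ler_wnM2l.
Qed.
End PathMaximal.

(** * Signs and last roots of real polynomials *)

Section PolyLimits.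
Variable R : rcfType.
Implicit Types (q : {poly R}) (t z : R).

Lemma last_root q t : t <= 0 -> 0 < q.[0] -> q.[t] <= 0 ->
  exists z, [/\ t <= z, z < 0, q.[z] = 0 & forall u, z < u -> u <= 0 -> 0 < q.[u]].
Proof.
move=> t0 q0 qt.
have [w /andP[tw w0] /rootP qw] := poly_ivt t0 (introT andP (conj qt (ltW q0))).
have {}w0 : w < 0.
  rewrite lt_neqAle w0 andbT; apply/eqP => e.
  by move: q0; rewrite -[in q.[0]]e qw ltxx.
have noneg z : {in `]z, 0[, forall u, ~~ root q u} ->
    forall u, z < u -> u <= 0 -> 0 < q.[u].
  move=> nr u zu u0; rewrite ltNge; apply/negP => qu.
  have [v /andP[uv v0] rv] := poly_ivt u0 (introT andP (conj qu (ltW q0))).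
  have : v \in `]z, 0[.
    rewrite in_itv /= (lt_le_trans zu uv) lt_neqAle v0 andbT.
    by apply/eqP => e; move: q0; rewrite -[in q.[0]]e (rootP rv) ltxx.
  by move/nr; rewrite rv.
(* The search starts at [t - 1] so that the open interval contains [w] even when [w = t]. *)
have tw1 : t - 1 < w by lra.
case: (@prev_rootP R q (t - 1) 0).
- by move=> e; move: q0; rewrite e horner0 ltxx.
- move=> z _ qz; rewrite in_itv /= => /andP[_ z0] nr; exists z; split=> //.
  + rewrite leNgt; apply/negP => zt.
    have /nr : w \in `]z, 0[ by rewrite in_itv /= w0 andbT (lt_le_trans zt).
    by rewrite /root qw eqxx.
  + exact: noneg nr.
- move=> z _ _ nr; have /nr : w \in `](t - 1), 0[ by rewrite in_itv /= w0 andbT.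
  by rewrite /root qw eqxx.
Qed.

(** If [q.[z] < 0], then [q - q.[z] / 2] changes sign to the right of [z], and at its root there [q]
    is negative. *)
Lemma poly_lim_ge0 q z : z < 0 ->
  (forall u, z < u -> u <= 0 -> 0 <= q.[u]) -> 0 <= q.[z].
Proof.
move=> z0 h; rewrite leNgt; apply/negP => qz.
set p := q - (q.[z] / 2)%:P.
have pz : p.[z] <= 0 by rewrite !hornerE; lra.
have pu u : z < u -> u <= 0 -> 0 < p.[u].
  by move=> zu u0; rewrite !hornerE; have := h u zu u0; lra.
have [w /andP[zw w0] /rootP pw] :=
  poly_ivt (ltW z0) (introT andP (conj pz (ltW (pu 0 z0 (lexx _))))).
have [e|wz] := eqVneq w z; first by move: pw; rewrite e !hornerE; lra.
have zw' : z < w by rewrite lt_neqAle eq_sym wz.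
by have := pu w zw' w0; rewrite pw ltxx.
Qed.

End PolyLimits.

(** * Positivity on an interval passes to induced subgraphs *)

Section IpPoly.
Variable G : sgraph.
Implicit Types (A B : {set G}).

Definition ipp (R : comNzRingType) A : {poly R} := ip A 'X.

Lemma horner_ipp (R : comNzRingType) A (x : R) : (ipp R A).[x] = ip A x.
Proof.
by rewrite /ipp /ip horner_sum; apply: eq_bigr => S _; rewrite !hornerE.
Qed.

Lemma ip_at0 (R : comNzRingType) A : ip A (0 : R) = 1.
Proof.
rewrite /ip (bigD1 set0) /=; last by rewrite sub0set ind0.
rewrite cards0 expr0 big1 ?addr0 // => S /andP[_ S0].
by rewrite expr0n cards_eq0 (negPf S0).
Qed.

Lemma independence_polyE (R : comNzRingType) :
  independence_poly G R = ipp R setT.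
Proof.
rewrite /independence_poly poly_def /ipp /ip.
have -> : \sum_(S : {set G} | (S \subset [set: G]) && independent S) 'X^#|S| =
   \sum_(S : {set G} | independent S) 'X^#|S| :> {poly R}.
  by apply: eq_bigl => S; rewrite subsetT.
have lt (S : {set G}) : (#|S| < #|G|.+1)%N by rewrite ltnS max_card.
rewrite (partition_big (fun S : {set G} => Ordinal (lt S)) predT) //=.
apply: eq_bigr => k _; rewrite /num_independent scaler_nat -sumr_const.
by apply: eq_big => [S|S]; [rewrite inE|rewrite inE => /andP[_ /eqP->]].
Qed.

Variable R : rcfType.

(* At the last zero [z] of [G - v], all smaller induced subgraphs are
   nonnegative, so the deletion recurrence gives [I(G, z) <= 0]. *)
Lemma hpos_of_pos A (x : R) :
  (forall t, x <= t -> t <= 0 -> 0 < ip A t) ->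
  forall t, x <= t -> t <= 0 -> hpos A t.
Proof.
have [n] := ubnP #|A|; elim: n A x => // n IH A x ltn posA.
have step v : v \in A -> forall t, x <= t -> t <= 0 -> 0 < ip (A :\ v) t.
  move=> vA t xt t0; rewrite ltNge; apply/negP => neg.
  have ltA : (#|A :\ v| < n)%N by rewrite (cardsD1 v A) vA in ltn *.
  have [||z [tz z0 qz pz]] := @last_root R (ipp R (A :\ v)) t t0.
  - by rewrite horner_ipp ip_at0.
  - by rewrite horner_ipp.
  have : 0 <= (ipp R (A :\: cN v)).[z].
    apply: poly_lim_ge0 => // u zu u0; rewrite horner_ipp; apply: ltW.
    apply: (IH (A :\ v) u ltA _ u (lexx _) u0).
      by move=> s us s0; rewrite -horner_ipp pz // (lt_le_trans zu).
    by apply: setDS; rewrite sub1set inE eqxx.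
  have := posA z (le_trans xt tz) (ltW z0).
  rewrite horner_ipp in qz; rewrite horner_ipp (ip_del z vA) qz add0r.
  by rewrite nmulr_rgt0 // leNgt => ->.
move=> t xt t0 B sBA.
have [->|neq] := eqVneq B A; first exact: posA.
have /subsetPn[v vA vB] : ~~ (A \subset B).
  by apply: contra neq => sAB; rewrite eqEsubset sBA.
have ltA : (#|A :\ v| < n)%N by rewrite (cardsD1 v A) vA in ltn *.
by apply: (IH (A :\ v) x ltA (step v vA) t xt t0); rewrite subsetD1 sBA.
Qed.

End IpPoly.

(** * The root [xi] and the order on graphs *)

Section Xi.
Variables (R : realType) (G : sgraph).

Lemma ip_xi_pos (t : R) : xi R G < t -> t <= 0 -> 0 < ip [set: G] t.
Proof.
(* In the branch without a smallest-modulus root, [xget] returns [0] and no [t] satisfies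
   [0 < t <= 0]. *)
rewrite /xi; case: classical_sets.xgetP => [r _ [_ rmin] rt t0|_ /lt_le_trans h /h];
  last by rewrite ltxx.
rewrite ltNge; apply/negP => neg.
(* A nonpositive value at [t] gives a real root [z] with [xi < t <= z < 0], of smaller modulus than
   [xi]. *)
have [||z [tz z0 qz _]] := @last_root R (ipp R [set: G]) t t0.
- by rewrite horner_ipp ip_at0.
- by rewrite horner_ipp.
have : root (independence_poly G R[i]) z%:C%C.
  rewrite independence_polyE rootE horner_ipp.
  have -> : ip [set: G] z%:C%C = (ip [set: G] z)%:C%C.
    by rewrite /ip rmorph_sum; apply: eq_bigr => S _; rewrite rmorphXn.
  by rewrite -horner_ipp qz.
move/rmin; rewrite !normc_def /= expr0n /= !addr0 !sqrtr_sqr lecR.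
by rewrite !ltr0_norm // ?lerN2 ?leNgt ?(lt_le_trans rt) //; apply: lt_le_trans rt t0.
Qed.

(** This removes complex roots from the rest of the argument: only positivity of [I(G, .)] on
    [[t, 0]] is kept. At [0] both polynomials equal [1]. *)
Lemma preceqI (H : sgraph) :
  (forall t : R, t < 0 -> (forall s, t <= s -> s <= 0 -> 0 < ip [set: G] s) ->
     ip [set: G] t <= ip [set: H] t) ->
  preceq R H G.
Proof.
move=> h x /andP[xix x0]; rewrite !independence_polyE -subr_ge0 -hornerN -hornerD.
have hh (t : R) : xi R G < t -> t <= 0 -> 0 <= (ipp R [set: H] - ipp R [set: G]).[t].
  move=> xit t0; rewrite hornerD hornerN !horner_ipp subr_ge0.
  have [->|tn0] := eqVneq t 0; first by rewrite !ip_at0.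
  apply: h; first by rewrite lt_neqAle tn0.
  by move=> s ts; apply: ip_xi_pos; apply: lt_le_trans ts.
move: x0; rewrite le_eqVlt => /predU1P[->|x0].
  by rewrite hornerD hornerN !horner_ipp !ip_at0 subrr.
apply: poly_lim_ge0 => // u xu; apply: hh; exact: le_lt_trans xu.
Qed.

End Xi.

(** * Summing out leaves; paths and cycles *)

Section Families.
Variable G : sgraph.
Implicit Types (A B L : {set G}) (u v : G).

Lemma ip_indep (R : comNzRingType) L (x : R) :
  {in L &, forall u v, ~~ edge u v} -> ip L x = (1 + x) ^+ #|L|.
Proof.
have [n] := ubnP #|L|; elim: n L => // n IH L ltn iL.
have [->|[v vL]] := set_0Vmem L; first by rewrite ip0 cards0.
have cL : #|L| = #|L :\ v|.+1 by rewrite (cardsD1 v L) vL.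
rewrite -{1}(setD1K vL) ip_disj => [|a b].
  have ltv : (#|L :\ v| < n)%N by rewrite -ltnS -cL.
  rewrite ip1 (IH _ ltv); first by rewrite cL exprS.
  move=> a b.
  by rewrite !inE => /andP[_ aL] /andP[_ bL]; apply: iL.
by rewrite !inE => /eqP-> /andP[bv bL]; rewrite eq_sym bv iL.
Qed.

(* The vertices of [L] are simplicial in [B :|: L], with pairwise disjoint
   neighbourhoods covering [B]; a clique [N(l)] contributes either
   nothing and leaves the choice [1 + x] at [l], or one vertex and no choice. *)
Lemma ip_whisker (R : fieldType) B L (lf : G -> G) (x : R) : 1 + x != 0 ->
  {in L &, forall u v, ~~ edge u v} ->
  {in B & L, forall u v, (u != v) && (edge u v == (v == lf u))} ->
  {in B, forall u, lf u \in L} ->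
  {in B &, forall u v, lf u = lf v -> u != v -> edge u v} ->
  ip (B :|: L) x = (1 + x) ^+ #|L| * ip B (x / (1 + x)).
Proof.
move=> x1 iL; have [n] := ubnP #|B|; elim: n B => // n IH B ltn eBL lB cB.
have [->|[b bB]] := set_0Vmem B; first by rewrite set0U ip0 mulr1 ip_indep.
have ltB : (#|B :\ b| < n)%N by rewrite (cardsD1 b B) bB in ltn *.
have IHs (C : {set G}) : C \subset B :\ b ->
    ip (C :|: L) x = (1 + x) ^+ #|L| * ip C (x / (1 + x)).
  move=> sC; have sCB : {subset C <= B}.
    by move=> z /(subsetP sC); rewrite !inE => /andP[].
  apply: IH.
  - exact: leq_ltn_trans (subset_leq_card sC) ltB.
  - by move=> u v /sCB uB; apply: eBL.
  - by move=> u /sCB; apply: lB.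
  - by move=> u v /sCB uB /sCB; apply: cB.
have lL := lB b bB; set l := lf b in lL.
rewrite (ip_del (v := b)) ?inE ?bB // (ip_del _ bB).
have bL : b \notin L by apply/negP => bL; have := eBL b b bB bL; rewrite eqxx.
have -> : (B :|: L) :\ b = (B :\ b) :|: L.
  by apply/setP => z; rewrite !inE; case: eqP => //= ->; rewrite (negPf bL).
have -> : (B :|: L) :\: cN b = (B :\: cN b) :|: (L :\ l).
  apply/setP => z; rewrite !inE; case: (boolP (z \in L)) => zL; last by rewrite !andbF !orbF.
  have /andP[bz /eqP->] := eBL b z bB zL; rewrite eq_sym (negPf bz) orbT /= !andbT.
  have [zB|_] := boolP (z \in B); last by rewrite andbF.
  by have := eBL z z zB zL; rewrite eqxx.
have sN : B :\: cN b \subset B :\ b by apply: setDS; rewrite sub1set inE eqxx.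
(* The induction hypothesis still contains [l]. A vertex of [B :\: cN b] joined to [l] would be
   adjacent to [b], so [l] is isolated there and its factor [1 + x] can be divided out. *)
have := IHs _ sN; rewrite (IHs _ (subxx _)).
have -> : (B :\: cN b) :|: L = ((B :\: cN b) :|: (L :\ l)) :|: [set l].
  by rewrite -setUA [_ :\ l :|: _]setUC setD1K.
rewrite ip_disj => [|u v].
  rewrite ip1 => h; set X := ip (_ :|: _ :\ l) x in h *.
  by rewrite -(mulfK x1 X) h; field.
rewrite !inE negb_or => /orP[/andP[/andP[ub nbu] uB]|/andP[ul uL]] /eqP->.
  have /andP[-> /eqP ->] := eBL u l uB lL; apply: contra nbu => /eqP e.
  by apply: cB => //; rewrite eq_sym.
by rewrite ul iL.
Qed.

Lemma ip_del2 (R : comNzRingType) A u v (x : R) : u \in A -> v \in A -> u != v ->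
  ~~ edge u v ->
  ip A x = ip (A :\ u :\ v) x + x * ip (A :\ u :\: cN v) x +
    x * (ip (A :\: cN u :\ v) x + x * ip (A :\: cN u :\: cN v) x).
Proof.
move=> uA vA uv nuv; rewrite (ip_del x uA); congr (_ + _ * _); apply: ip_del.
  by rewrite !inE eq_sym uv vA.
by rewrite !inE eq_sym (negPf uv) (negPf nuv).
Qed.

(* On the pentagon, summing out [c3] and [c4] leaves the same weights on [c0, c2]
   as a path [c0 - c1 - c2] at the point [x / (1 + x)]. *)
Lemma ip_five (R : fieldType) B L (lf : G -> G) (x : R) (c0 c1 c2 c3 c4 : G) :
  1 + x != 0 ->
  {in L &, forall u v, ~~ edge u v} ->
  {in B & L, forall u v, (u != v) && (edge u v == (v == lf u))} ->
  {in B, forall u, lf u \in L} ->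
  {in B &, forall u v, lf u = lf v -> u != v -> edge u v} ->
  uniq [:: c0; c1; c2; c3; c4] ->
  {in [:: c0; c1; c2; c3; c4], forall c, (c \notin B) && (c \notin L)} ->
  [&& edge c0 c1, edge c1 c2, edge c2 c3, edge c3 c4 & edge c4 c0] ->
  [&& ~~ edge c0 c2, ~~ edge c0 c3, ~~ edge c1 c3, ~~ edge c1 c4 & ~~ edge c2 c4] ->
  {in B :|: L, forall z, [&& ~~ edge c1 z, ~~ edge c3 z & ~~ edge c4 z]} ->
  {in L, forall z, ~~ edge c0 z && ~~ edge c2 z} ->
  ip (B :|: L :|: [set z in [:: c0; c1; c2; c3; c4]]) x =
    (1 + x) ^+ #|L|.+2 * ip (B :|: [set z in [:: c0; c1; c2]]) (x / (1 + x)).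
Proof.
move=> x1 iL eBL lB cB un ncBL edg nedg nBL nL.
have wh (C : {set G}) : C \subset B ->
    ip (C :|: L) x = (1 + x) ^+ #|L| * ip C (x / (1 + x)).
  move=> /subsetP sC; apply: (@ip_whisker _ _ _ lf) => // [u v /sC|u /sC|u v /sC uB /sC].
  - exact: eBL.
  - exact: lB.
  - exact: cB.
have cs z : z \in [:: c0; c1; c2; c3; c4] -> (z \in B) = false /\ (z \in L) = false.
  by move=> /ncBL/andP[/negPf-> /negPf->].
have [B0 L0] := cs c0 ltac:(by rewrite !inE eqxx ?orbT).
have [B1 L1] := cs c1 ltac:(by rewrite !inE eqxx ?orbT).
have [B2 L2] := cs c2 ltac:(by rewrite !inE eqxx ?orbT).
have [B3 L3] := cs c3 ltac:(by rewrite !inE eqxx ?orbT).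
have [B4 L4] := cs c4 ltac:(by rewrite !inE eqxx ?orbT).
move: un; rewrite /= !inE !negb_or => /and5P[/and4P[n01 n02 n03 n04] /and3P[n12 n13 n14] /andP[n23 n24] n34 _].
case/and5P: edg => e01 e12 e23 e34 e40; case/and5P: nedg => e02 e03 e13 e14 e24.
have nn := (negPf n01, negPf n02, negPf n03, negPf n04, negPf n12, negPf n13,
  negPf n14, negPf n23, negPf n24, negPf n34).
have nn' : (((c1 == c0) = false) * ((c2 == c0) = false) * ((c3 == c0) = false) * ((c4 == c0) = false)
  * ((c2 == c1) = false) * ((c3 == c1) = false) * ((c4 == c1) = false) * ((c3 == c2) = false)
  * ((c4 == c2) = false) * ((c4 == c3) = false))%type.
  by do !split; rewrite eq_sym nn.
have ee := (e01, e12, e23, e34, e40, negPf e02, negPf e03, negPf e13, negPf e14, negPf e24).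
have ee' : ((edge c1 c0 = true) * (edge c2 c1 = true) * (edge c3 c2 = true) * (edge c4 c3 = true)
  * (edge c0 c4 = true) * (edge c2 c0 = false) * (edge c3 c0 = false) * (edge c3 c1 = false)
  * (edge c4 c1 = false) * (edge c4 c2 = false))%type.
  by do !split; rewrite edgeC ee.
have mem := (B0, L0, B1, L1, B2, L2, B3, L3, B4, L4).
have nB0 z : z \in L -> edge c0 z = false by move/nL => /andP[/negPf].
have nB2 z : z \in L -> edge c2 z = false by move/nL => /andP[_ /negPf].
have ext (D E : {set G}) :
    [&& (c0 \in D) == (c0 \in E), (c1 \in D) == (c1 \in E), (c2 \in D) == (c2 \in E),
        (c3 \in D) == (c3 \in E) & (c4 \in D) == (c4 \in E)] ->
    (forall z, z \notin [:: c0; c1; c2; c3; c4] -> (z \in D) = (z \in E)) -> D = E.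
  move=> /and5P[/eqP h0 /eqP h1 /eqP h2 /eqP h3 /eqP h4] h; apply/setP => z.
  have [|/h//] := boolP (z \in [:: c0; c1; c2; c3; c4]).
  by rewrite !inE => /predU1P[->|/or4P[]/eqP->].
rewrite (@ip_del2 _ _ c0 c2); try by rewrite ?inE ?eqxx ?orbT // ?n02 ?e02.
rewrite (@ip_del2 _ (B :|: [set z in [:: c0; c1; c2]]) c0 c2); try by rewrite ?inE ?eqxx ?orbT // ?n02 ?e02.
set V := _ :|: [set z in [:: c0; c1; c2; c3; c4]]; set F := _ :|: [set z in [:: c0; c1; c2]].
set B1' := B :\: cN c0; set B2' := B :\: cN c2.
have go := (mem, nn, nn', ee, ee', eqxx, edgexx, nB0, nB2).
have outl z : z \notin [:: c0; c1; c2; c3; c4] ->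
    ((z == c0) = false) * ((z == c1) = false) * ((z == c2) = false) *
    ((z == c3) = false) * ((z == c4) = false).
  by rewrite !inE !negb_or => /and5P[/negPf-> /negPf-> /negPf-> /negPf-> /negPf->].
(* The four choices for [c0] and [c2] leave on the pentagon the weights [(1 + x) * (1 + 2 * x)],
   twice [x * (1 + x)], and [x ^+ 2]. These are [(1 + x) ^+ 2] times [1 + y], [y], [y], [y ^+ 2] at
   [y = x / (1 + x)]. *)
have V1 : V :\ c0 :\ c2 = (B :|: L) :|: ([set c1] :|: [set c3; c4]).
  apply: ext => [|z]; first by rewrite !inE !go.
  by move=> /outl h; rewrite !inE !h !orbF.
have V2 : V :\ c0 :\: cN c2 = (B2' :|: L) :|: [set c4].
  apply: ext => [|z]; first by rewrite !inE !go ?orbT ?andbF.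
  move=> /outl h; rewrite !inE !h /= !orbF.
  by have [/nB2->|_] := boolP (z \in L); rewrite ?orbT ?orbF.
have V3 : V :\: cN c0 :\ c2 = (B1' :|: L) :|: [set c3].
  apply: ext => [|z]; first by rewrite !inE !go ?orbT ?andbF.
  move=> /outl h; rewrite !inE !h /= !orbF.
  by have [/nB0->|_] := boolP (z \in L); rewrite ?orbT ?orbF.
have V4 : V :\: cN c0 :\: cN c2 = (B1' :\: cN c2) :|: L.
  apply: ext => [|z]; first by rewrite !inE !go ?orbT ?andbF.
  move=> /outl h; rewrite !inE !h /= !orbF.
  by have [zL|_] := boolP (z \in L); rewrite ?orbF // !orbT nB0 ?nB2.
have F1 : F :\ c0 :\ c2 = B :|: [set c1].
  apply: ext => [|z]; first by rewrite !inE !go ?orbT ?andbF.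
  by move=> /outl h; rewrite !inE !h /= !orbF.
have F2 : F :\ c0 :\: cN c2 = B2'.
  apply: ext => [|z]; first by rewrite !inE !go ?orbT ?andbF.
  by move=> /outl h; rewrite !inE !h /= !orbF.
have F3 : F :\: cN c0 :\ c2 = B1'.
  apply: ext => [|z]; first by rewrite !inE !go ?orbT ?andbF.
  by move=> /outl h; rewrite !inE !h /= !orbF.
have F4 : F :\: cN c0 :\: cN c2 = B1' :\: cN c2.
  apply: ext => [|z]; first by rewrite !inE !go ?orbT ?andbF.
  by move=> /outl h; rewrite !inE !h /= !orbF.
have dj (C D : {set G}) : C \subset B -> D \subset [set c1; c3; c4] ->
    {in C :|: L & D, forall u v, (u != v) && ~~ edge u v}.
  move=> /subsetP sC /subsetP sD u v uC /sD vD.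
  have uBL : u \in B :|: L.
    by move: uC; rewrite !inE => /orP[/sC->|->]; rewrite ?orbT.
  have /and3P[h1 h3 h4] := nBL u uBL.
  have nu c : c \in [:: c0; c1; c2; c3; c4] -> u != c.
    move=> /cs[bc lc]; apply: contraTneq uBL => ->; by rewrite inE bc lc.
  by move: vD; rewrite !inE -orbA => /or3P[]/eqP->; rewrite edgeC nu ?inE ?eqxx ?orbT.
have sB1 : B1' \subset B by apply: subsetDl.
have sB2 : B2' \subset B by apply: subsetDl.
have sB3 : B1' :\: cN c2 \subset B by apply: subset_trans sB1; apply: subsetDl.
rewrite V1 V2 V3 V4 F1 F2 F3 F4.
have s134 : [set c1] :|: [set c3; c4] \subset [set c1; c3; c4].
  by apply/subsetP => z; rewrite !inE orbA.
have s4 : [set c4] \subset [set c1; c3; c4] by rewrite sub1set !inE eqxx orbT.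
have s3 : [set c3] \subset [set c1; c3; c4] by rewrite sub1set !inE eqxx orbT.
have s1 : [set c1] \subset [set c1; c3; c4] by rewrite sub1set !inE eqxx.
have d1 : {in [set c1] & [set c3; c4], forall u v, (u != v) && ~~ edge u v}.
  by move=> u v; rewrite !inE => /eqP-> /orP[]/eqP->; rewrite !go.
have dB : {in B & [set c1], forall u v, (u != v) && ~~ edge u v}.
  by move=> u v uB; apply: dj (subxx B) s1 _ _ _; rewrite inE uB.
rewrite (ip_disj _ (dj _ _ (subxx B) s134)) (ip_disj _ (dj _ _ sB2 s4)).
rewrite (ip_disj _ (dj _ _ sB1 s3)) (ip_disj _ d1) (ip_disj _ dB).
rewrite !wh // !ip1.
have -> : ip [set c3; c4] x = 1 + x + x.
  rewrite (@ip_del _ _ _ c3) ?inE ?eqxx //.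
  have -> : [set c3; c4] :\ c3 = [set c4].
    by apply/setP => z; rewrite !inE; case: eqP => //= ->; rewrite nn.
  have -> : [set c3; c4] :\: cN c3 = set0.
    by apply/setP => z; rewrite !inE; case: eqP => //= _; case: eqP => [->|]; rewrite ?e34 ?andbF.
  by rewrite ip1 ip0 mulr1.
rewrite -/B1' -/B2' !exprS; by field.
Qed.

Lemma pos_surj A (pos : G -> nat) N : #|A| = N ->
  {in A, forall v, (pos v < N)%N} -> {in A &, injective pos} ->
  forall i, (i < N)%N -> exists2 v, v \in A & pos v = i.
Proof.
case: N => // N cA ltp inj i ltiN.
have inj' : {in A &, injective (fun v => inord (pos v) : 'I_N.+1)}.
  move=> u v uA vA /(congr1 val); rewrite /= !inordK ?ltp //; exact: inj.
have := card_in_imset inj'; rewrite cA => e.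
have : Ordinal ltiN \in [set (inord (pos v) : 'I_N.+1) | v in A].
  have /eqP -> : [set (inord (pos v) : 'I_N.+1) | v in A] == setT.
    by rewrite eqEcard subsetT cardsT card_ord e leqnn.
  by rewrite inE.
by case/imsetP => v vA /(congr1 val); rewrite /= inordK ?ltp // => ->; exists v.
Qed.

(** A numbering of [A] takes the place of an isomorphism, so that paths inside a larger graph are
    covered. The vertex with the last number is deleted. *)
Lemma ip_path (R : comNzRingType) A (pos : G -> nat) N (y : R) : #|A| = N ->
  {in A, forall v, (pos v < N)%N} -> {in A &, injective pos} ->
  {in A &, forall u v, edge u v = (pos v == (pos u).+1) || (pos u == (pos v).+1)} ->
  ip A y = pathv y N.+1.
Proof.
elim/ltn_ind: N A => N IH A cA ltp inj eA.
case: N IH cA ltp => [|N] IH cA ltp.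
  by rewrite (cards0_eq cA) ip0.
have [v vA pv] := pos_surj cA ltp inj (ltnSn N).
have cAv : #|A :\ v| = N by move: cA; rewrite (cardsD1 v) vA => -[].
have sAv : {subset A :\ v <= A} by move=> z; rewrite inE => /andP[].
have ltpv : {in A :\ v, forall u, (pos u < N)%N}.
  move=> u; rewrite !inE => /andP[uv uA]; have := ltp u uA.
  rewrite ltnS leq_eqVlt => /predU1P[e|//]; move: uv.
  by rewrite (inj u v uA vA) ?eqxx // e pv.
have injv : {in A :\ v &, injective pos} by apply: sub_in2 inj.
rewrite (ip_del y vA) (IH N) //; last by move=> a b /sAv aA /sAv; apply: eA.
case: N IH cA ltp pv cAv ltpv => [|N] IH cA ltp pv cAv ltpv.
  have -> : A :\: cN v = set0.
    apply/eqP; rewrite -subset0 -(cards0_eq cAv); apply: setDS.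
    by rewrite sub1set inE eqxx.
  by rewrite ip0.
have [w wA pw] := pos_surj cAv ltpv injv (ltnSn N).
have wA' := sAv w wA.
have -> : A :\: cN v = A :\ v :\ w.
  apply/setP => z; rewrite !inE; have [->|zv] := eqVneq z v; first by rewrite andbF.
  have [zA|] := boolP (z \in A); last by rewrite !andbF.
  rewrite /= ?andbT eA // pv; congr negb; apply/orP/eqP => [[/eqP e|/eqP[e]]|->].
  - by have := ltp z zA; rewrite e ltnn.
  - by apply: inj => //; rewrite pw.
  - by right; rewrite pw.
have cAw : #|A :\ v :\ w| = N by move: cAv; rewrite (cardsD1 w) wA => -[].
have sAw : {subset A :\ v :\ w <= A :\ v} by move=> z; rewrite inE => /andP[].
rewrite (IH N) ?pathvSS //.
- move=> u; rewrite !inE => /and3P[uw uv uA].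
  have := ltpv u; rewrite !inE uv uA => /(_ isT).
  rewrite ltnS leq_eqVlt => /predU1P[e|//]; move: uw.
  by rewrite (inj u w) ?eqxx // e pw.
- by apply: sub_in2 injv.
- by move=> a b /sAw/sAv aA /sAw/sAv; apply: eA.
Qed.

(** Deleting the vertex numbered [0] leaves a path on [N.+2] vertices; deleting its two neighbours
    as well leaves one on [N] vertices. *)
Lemma ip_cycle (R : comNzRingType) (pos : G -> nat) N (x : R) : #|G| = N.+3 ->
  (forall v, (pos v < N.+3)%N) -> injective pos ->
  (forall u v, edge u v = (pos v == (pos u).+1 %% N.+3)%N || (pos u == (pos v).+1 %% N.+3)%N) ->
  ip [set: G] x = pathv x N.+3 + x * pathv x N.+1.
Proof.
move=> cG ltp inj eG.
have cT : #|[set: G]| = N.+3 by rewrite cardsT.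
have [v _ pv] := pos_surj cT (in1W ltp) (in2W inj) (ltn0Sn _).
have modS m : (m < N.+3)%N -> (m.+1 %% N.+3)%N = if m == N.+2 then 0%N else m.+1.
  rewrite ltnS leq_eqVlt => /orP[/eqP->|h]; first by rewrite eqxx modnn.
  by rewrite ltn_eqF // modn_small.
have {}eG u w : edge u w = (pos w == if pos u == N.+2 then 0%N else (pos u).+1)
    || (pos u == if pos w == N.+2 then 0%N else (pos w).+1).
  by rewrite eG !modS.
have evz z : z != v -> (0 < pos z)%N.
  by rewrite lt0n; apply: contraNneq => e; apply/eqP; apply: inj; rewrite e pv.
rewrite (ip_del x (in_setT v)).
have cTv : #|[set: G] :\ v| = N.+2 by move: cT; rewrite (cardsD1 v) inE => -[].
rewrite (@ip_path _ _ (fun z => (pos z).-1) N.+2) //; first last.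
- move=> a b; rewrite !inE !andbT => /evz pa /evz pb; rewrite eG.
  by move: (ltp a) (ltp b) pa pb; case: (pos a =P N.+2); case: (pos b =P N.+2); lia.
- move=> a b; rewrite !inE !andbT => /evz pa /evz pb e; apply: inj; lia.
- by move=> a; rewrite !inE !andbT => /evz pa; have := ltp a; lia.
congr (_ + _ * _).
have eN z : (z \in [set: G] :\: cN v) = (1 < pos z < N.+2)%N.
  rewrite !inE andbT eG pv /=.
  have [->|/evz pz] := eqVneq z v; first by rewrite pv.
  by have := ltp z; case: (pos z =P N.+2); lia.
have mN z : z \in [set: G] :\: cN v -> (1 < pos z < N.+2)%N by rewrite eN.
have [a _ pa] := pos_surj cT (in1W ltp) (in2W inj) (isT : (1 < N.+3)%N).
have [b _ pb] := pos_surj cT (in1W ltp) (in2W inj) (ltnSn N.+2).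
rewrite (@ip_path _ _ (fun z => (pos z).-2) N) //; first last.
- move=> u w /mN pu /mN pw; rewrite eG.
  by move: pu pw; case: (pos u =P N.+2); case: (pos w =P N.+2); lia.
- move=> u w /mN pu /mN pw e; apply: inj; lia.
- by move=> u /mN; lia.
have -> : [set: G] :\: cN v = [set: G] :\ v :\ a :\ b.
  apply/setP => z; rewrite eN !inE !andbT.
  have h (c : G) : (z == c) = (pos z == pos c) by rewrite (inj_eq inj).
  by rewrite !h pv pa pb; have := ltp z; lia.
move: cTv; rewrite (cardsD1 a) !inE -(inj_eq inj) pa pv /= add1n => -[].
by rewrite (cardsD1 b) !inE -!(inj_eq inj) pa pb pv /= add1n => -[].
Qed.

End Families.

(** * Well-covered graphs and leaf-support pairs *)

Section WellCovered.
Variable G : sgraph.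
Implicit Types (A B C S M K : {set G}) (u v w s l : G).

Definition mis A S :=
  [&& S \subset A, independent S & [forall v in A :\: S, exists u in S, edge u v]].

Definition wc A := forall S1 S2, mis A S1 -> mis A S2 -> #|S1| = #|S2|.

Definition nb A v : {set G} := [set u in A | edge v u].

Definition noiso A := forall v, v \in A -> nb A v != set0.

Lemma mis_ext A S : S \subset A -> independent S -> exists2 M, mis A M & S \subset M.
Proof.
move=> sSA iS.
have [M /maxsetP[/andP[sMA iM] maxM] sSM] :=
  @maxset_exists _ (fun T : {set G} => (T \subset A) && independent T) S (introT andP (conj sSA iS)).
exists M => //; apply/and3P; split=> //; apply/forall_inP => v; rewrite inE => /andP[vM vA].
apply/exists_inP; apply/exists_inP; apply: contraR vM => h.
have iv : independent (v |: M).
  rewrite ind_setU1 iM /=; apply/forall_inP => u uM; rewrite edgeC.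
  by move: h; rewrite negb_exists_in => /forall_inP/(_ u uM).
by rewrite -(maxM (v |: M)) ?setU11 ?subsetUr // subUset sub1set vA sMA iv.
Qed.

Lemma mis_nbr A S v : mis A S -> v \in A -> v \notin S -> exists2 u, u \in S & edge u v.
Proof.
case/and3P=> _ _ /forall_inP h vA vS.
by have /exists_inP[u uS e] := h v ltac:(by rewrite inE vS vA); exists u.
Qed.

Lemma mis_indep A S u v : mis A S -> u \in S -> v \in S -> edge u v = false.
Proof. by case/and3P=> _ /indP h _ uS vS; apply/negbTE/h. Qed.

Lemma mis_sub A S : mis A S -> S \subset A.
Proof. by case/and3P. Qed.

Lemma well_covered_wc : well_covered G -> wc [set: G].
Proof.
move=> h S1 S2 h1 h2; have mx S : mis [set: G] S -> maxset (@independent G) S.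
  move=> hS; case/and3P: (hS) => _ iS _; apply/maxsetP; split=> // B /indP iB sSB.
  apply/eqP; rewrite eqEsubset sSB andbT; apply/subsetP => v vB.
  apply: contraT => vS; have [u uS e] := mis_nbr hS (in_setT v) vS.
  by have := iB u v (subsetP sSB u uS) vB; rewrite e.
by apply: h; apply: mx.
Qed.

Lemma nbP A v s : nb A v = [set s] ->
  [/\ s \in A, edge v s & forall u, u \in A -> edge v u -> u = s].
Proof.
move/setP => e; have := e s; rewrite !inE eqxx => /andP[sA vs]; split=> // u uA vu.
by have := e u; rewrite !inE uA vu => /esym/eqP.
Qed.

(** [l] dominates [s], and [s] is the only neighbour of [l], so neither independence nor maximality
    is lost. *)
Lemma mis_leaf A s l M : l \in A -> nb A l = [set s] ->
  mis (A :\: [set s; l]) M -> mis A (l |: M) /\ l \notin M.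
Proof.
move=> lA /nbP[sA ls uq] hM.
have sM := mis_sub hM.
have lM : l \notin M by apply/negP => /(subsetP sM); rewrite !inE eqxx orbT.
have inA z : z \in M -> z \in A /\ z != s.
  by move/(subsetP sM); rewrite !inE negb_or => /andP[/andP[-> _] ->].
split=> //; apply/and3P; split.
- rewrite subUset sub1set lA; apply/subsetP => z /inA[] //.
- case/and3P: (hM) => _ iM _; rewrite ind_setU1 iM; apply/forall_inP => u /inA[uA us].
  by apply: contra us => /(uq u uA)->.
- apply/forall_inP => v; rewrite !inE negb_or => /andP[/andP[vl vM] vA].
  apply/exists_inP; have [->|vs] := eqVneq v s; first by exists l; rewrite ?setU11.
  have [|u uM e] := mis_nbr hM _ vM; first by rewrite !inE negb_or vs vl.
  by exists u => //; rewrite inE uM orbT.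
Qed.

Lemma wc_leaf A s l : l \in A -> nb A l = [set s] -> wc A -> wc (A :\: [set s; l]).
Proof.
move=> lA nl wA S1 S2 /(mis_leaf lA nl)[m1 l1] /(mis_leaf lA nl)[m2 l2].
by have := wA _ _ m1 m2; rewrite !cardsU1 l1 l2 => /addnI.
Qed.

(* A vertex isolated by the removal would be a second leaf at [s]; replacing [s]
   by both leaves enlarges an independent set. *)
Lemma noiso_leaf A s l : l \in A -> nb A l = [set s] -> wc A -> noiso A ->
  noiso (A :\: [set s; l]).
Proof.
move=> lA nl wA nA z; rewrite !inE negb_or => /andP[/andP[zs zl] zA].
have [sA ls uq] := nbP nl.
apply/negP => /eqP e0.
have nz : nb A z = [set s].
  apply/eqP; move: (nA z zA); have : nb A z \subset [set s].
    apply/subsetP => u; rewrite !inE => /andP[uA zu]; apply: contraT => us.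
    have ul : u != l.
      by apply: contraNneq zs => e; rewrite (uq z zA) // edgeC -e.
    by move/setP/(_ u): e0; rewrite !inE negb_or us ul uA zu.
  by rewrite subset1 => /orP[|->].
have [_ zs' uqz] := nbP nz.
have [M mM sM] := @mis_ext A [set s] ltac:(by rewrite sub1set)
  ltac:(by apply/indP => u v; rewrite !inE => /eqP-> /eqP->; rewrite edgexx).
have {}sM : s \in M by rewrite (subsetP sM) // inE.
have MA := mis_sub mM.
have lM : l \notin M by apply/negP => lM; have := mis_indep mM lM sM; rewrite ls.
have zM : z \notin M by apply/negP => zM; have := mis_indep mM zM sM; rewrite zs'.
case/and3P: (mM) => _ iM _.
have iT : independent (z |: (l |: (M :\ s))).
  rewrite !ind_setU1 (ind_sub (subsetDl _ _) iM) /=; apply/andP; split.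
    apply/forall_inP => u; rewrite !inE => /andP[us uM].
    by apply: contra us => /(uq u (subsetP MA u uM))->.
  apply/forall_inP => u; rewrite !inE => /predU1P[->|/andP[us uM]].
    by apply: contraL ls => /(uqz l lA)->; rewrite edgexx.
  by apply: contra us => /(uqz u (subsetP MA u uM))->.
have sT : z |: (l |: (M :\ s)) \subset A.
  by rewrite !subUset !sub1set zA lA (subset_trans (subsetDl _ _) MA).
have [N mN sTN] := mis_ext sT iT.
have := wA _ _ mM mN; have := subset_leq_card sTN.
rewrite !cardsU1 !inE (negPf zM) (negPf lM) (negPf zl) !andbF /= (cardsD1 s M) sM.
by clear; clear; lia.
Qed.

Lemma leaf_of_le1 A w : noiso A -> w \in A -> (#|nb A w| <= 1)%N ->
  exists s, nb A w = [set s].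
Proof.
move=> nA wA; rewrite leq_eqVlt ltnS leqn0 cards_eq0 (negPf (nA w wA)) orbF.
by move/cards1P.
Qed.

Lemma card_leafD A s l : l \in A -> nb A l = [set s] -> #|A| = #|A :\: [set s; l]|.+2.
Proof.
move=> lA /nbP[sA ls _]; rewrite -(cardsID [set s; l] A).
rewrite (setIidPr _) ?cards2 ?subUset ?sub1set ?sA //.
by have -> : s != l by apply: contraTneq ls => ->; rewrite edgexx.
Qed.

(** The third hypothesis says that [A] induces a forest. Removing a leaf with its support preserves
    all hypotheses and the parity. *)
Lemma wc_forest_even A : wc A -> noiso A ->
  (forall B, B \subset A -> B != set0 -> exists2 w, w \in B & (#|nb B w| <= 1)%N) ->
  ~~ odd #|A|.
Proof.
have [n] := ubnP #|A|; elim: n A => // n IH A ltn wA nA fA.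
have [->|A0] := eqVneq A set0; first by rewrite cards0.
have [w wA' /(leaf_of_le1 nA wA')[s nw]] := fA A (subxx _) A0.
rewrite (card_leafD wA' nw) /= negbK; apply: IH.
- by move: ltn; rewrite (card_leafD wA' nw); clear; lia.
- exact: wc_leaf.
- exact: noiso_leaf.
- by move=> B sB; apply: fA; apply: subset_trans sB (subsetDl _ _).
Qed.

(* Leaf-support pairs are removed until only [C] is left. A support in [C] would
   leave a well-covered forest, which has even order. *)
Lemma wc_core_matching C A : 
  (forall B, C \subset B -> B != C -> exists2 w, w \in B :\: C & (#|nb B w| <= 1)%N) ->
  (forall s B, s \in C -> s \notin B -> B != set0 -> exists2 w, w \in B & (#|nb B w| <= 1)%N) ->
  C \subset A -> wc A -> noiso A -> odd #|A| ->
  exists m : G -> G, [/\ {in A :\: C, forall v, [&& m v \in A :\: C, m (m v) == v & edge v (m v)]},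
    wc C, odd #|C| & forall M K, mis A M -> mis C K -> #|M|.*2 = (#|A :\: C| + #|K|.*2)%N].
Proof.
move=> dC fC; have [n] := ubnP #|A|; elim: n A => // n IH A ltn sCA wA nA oA.
have [e|AC] := eqVneq A C.
  exists id; rewrite -e setDv; split=> // [v|M K m1 m2]; first by rewrite inE.
  by rewrite cards0 add0n (wA _ _ m1 m2).
have [w wAC] := dC A sCA AC; have [wA' wC] : w \in A /\ w \notin C.
  by move: wAC; rewrite inE => /andP[].
case/(leaf_of_le1 nA wA') => s nw; have [sA ws uq] := nbP nw.
have wA1 := wc_leaf wA' nw wA; have nA1 := noiso_leaf wA' nw wA nA.
have cA := card_leafD wA' nw.
have [sC|sC] := boolP (s \in C).
  have : ~~ odd #|A :\: [set s; w]|.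
    apply: wc_forest_even => // B sB B0; apply: (fC s) => //.
    by apply/negP => /(subsetP sB); rewrite !inE eqxx.
  by move: oA; rewrite cA /= negbK => ->.
have sw : s != w by apply: contraTneq ws => ->; rewrite edgexx.
have [|||||m [mP wC' oC mc]] := IH (A :\: [set s; w]).
- by move: ltn; rewrite cA; clear; lia.
- apply/subsetP => z zC; rewrite !inE (subsetP sCA z zC) andbT negb_or.
  by apply/andP; split; apply: contraTneq zC => ->.
- exact: wA1.
- exact: nA1.
- by move: oA; rewrite cA /= negbK.
exists (fun v => if v == s then w else if v == w then s else m v); split=> //.
  move=> v; rewrite !inE => /andP[vC vA].
  have [->|vs] := eqVneq v s.
    have /negPf-> : w != s by rewrite eq_sym.
    by rewrite wC wA' !eqxx edgeC ws.
  have [->|vw] := eqVneq v w; first by rewrite sC sA !eqxx ws.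
  have := mP v; rewrite !inE negb_or vs vw vC vA => /(_ isT).
  by rewrite negb_or => /and3P[/and3P[-> /andP[/negPf-> /negPf->] ->] -> ->].
move=> M K mM mK.
(* All maximal independent sets of [A] have the same size, so it can be computed on [w |: M']. *)
have [M' mM' _] := @mis_ext (A :\: [set s; w]) set0 (sub0set _) (ind0 G).
have [mM1 wM'] := mis_leaf wA' nw mM'.
rewrite (wA _ _ mM mM1) cardsU1 wM' doubleD (mc _ _ mM' mK).
have -> : #|A :\: C| = #|(A :\: [set s; w]) :\: C|.+2.
  rewrite (cardsD1 s) (cardsD1 w (_ :\ s)) !inE sC sA wC wA' eq_sym sw /= !add1n; do 2 congr _.+1.
  by apply: eq_card => z; rewrite !inE negb_or; case: (z == s); case: (z == w); rewrite ?andbF.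
by rewrite !addSn.
Qed.

End WellCovered.

(** * The unique cycle and the bridges off it *)

Section Unicyclic.
Variable G : sgraph.
Implicit Types (A B C S : {set G}) (u v w : G).

Lemma conn_setT : graph_connected G -> conn [set: G].
Proof.
move=> [_ cG] B _ /set0Pn[u uB] BT.
case: (boolP [exists u in B, exists v in ~: B, edge u v]).
  case/exists_inP => a aB /exists_inP[b bB e]; exists a, b; split=> //.
  by move: bB; rewrite !inE => ->.
rewrite negb_exists_in => /forall_inP h.
have cl : closed (@edge G) (mem B).
  apply: intro_closed; first by apply: sym_connect_sym; exact: edge_sym.
  move=> x y e xB; apply: contraT => yB; move: (h x xB); rewrite negb_exists_in.
  by move/forall_inP/(_ y); rewrite inE yB e => /(_ isT).
case/eqP: BT; apply/setP => v; rewrite inE.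
by have := closed_connect cl (cG u v); rewrite uB => <-.
Qed.

Lemma conn_connect A u v : conn A -> u \in A -> v \in A ->
  connect [rel x y | [&& x \in A, y \in A & edge x y]] u v.
Proof.
move=> cA uA vA; set r := [rel x y | _].
have [B0|Bn] := eqVneq [set z in A | connect r u z] A.
  by move: vA; rewrite -B0 inE => /andP[].
have [||a [b []]] := cA [set z in A | connect r u z] _ _ Bn.
- by apply/subsetP => z; rewrite inE => /andP[].
- by apply/set0Pn; exists u; rewrite inE uA connect0.
rewrite !inE => /andP[aA ua] /andP[h bA] e.
move: h; rewrite bA (connect_trans ua) //.
by apply: connect1; rewrite /r /= aA bA e.
Qed.

(** A simple path from [u] to [v] avoiding the edge [uv] closes with it to a cycle, which by
    uniqueness has the edges of [c]. *)
Lemma bridge c u v : (forall d : seq G, is_cycle d -> cycle_edges d = cycle_edges c) ->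
  edge u v ->
  connect [rel x y | edge x y && ([set x; y] != [set u; v])] u v ->
  [set u; v] \in cycle_edges c.
Proof.
move=> uq euv /connectP[p0 pp0 lv0]; case/shortenP: pp0 lv0 => p pp up _ lv.
have pe : path (@edge G) u p by apply: sub_path pp => x y /andP[].
have sz : (2 <= size p)%N.
  case: p pp up lv pe => [|x [|y p]] //=.
    by move=> _ _ e; move: euv; rewrite e edgexx.
  by move=> /andP[/andP[_ h] _] _ e; move: h; rewrite e eqxx.
rewrite -(uq (u :: p)); last first.
  split; last by rewrite /= ltnS.
  apply/andP; split; last exact: up.
  by rewrite /= rcons_path pe -lv edgeC.
apply/imsetP; exists v; first by rewrite lv mem_last.
have -> : next (u :: p) v = u.
  by rewrite next_nth lv mem_last index_last // nth_default.
by rewrite setUC.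
Qed.

Lemma next_iter_cycle c u v : uniq c -> u \in c -> v \in c ->
  exists n, v = iter n (next c) u.
Proof.
move=> uc uC vC; have := fconnect_cycle (cycle_next uc) uC v; rewrite vC.
by move/iter_findex => <-; exists (findex (next c) u v).
Qed.

Lemma next_out c A : uniq c -> A != set0 -> A \subset [set z in c] ->
  A != [set z in c] -> exists2 a, a \in A & next c a \notin A.
Proof.
move=> uc /set0Pn[a aA] sA An.
case: (boolP [exists a in A, next c a \notin A]) => [/exists_inP[b]|]; first by exists b.
rewrite negb_exists_in => /forall_inP h; case/eqP: An.
apply/eqP; rewrite eqEsubset sA; apply/subsetP => v; rewrite inE => vC.
have aC : a \in c by have := subsetP sA a aA; rewrite inE.
have [n ->] := next_iter_cycle uc aC vC.
by elim: n => //= n IH; have := h _ IH; rewrite negbK.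
Qed.

(* The last property says that the edges off the cycle are bridges. *)
Lemma unicyclic_core : graph_connected G -> unicyclic G -> exists c : seq G,
  [/\ uniq c, (3 <= size c)%N,
   {in c &, forall u v, edge u v = (v == next c u) || (u == next c v)} &
   forall w A, w \notin c -> conn A -> w \notin A ->
     {in nb A w &, forall u v, u = v}].
Proof.
move=> cG [c [[/andP[cyc uc] sz] uq]]; exists c; split=> //.
- move=> u v uC vC; apply/idP/idP => [e|/orP[]/eqP->]; last 2 first.
  + exact: next_cycle.
  + by rewrite edgeC; apply: next_cycle.
  apply: contraT; rewrite negb_or => /andP[nv nu].
  have : [set u; v] \in cycle_edges c.
    (* Going around the cycle from [u] to [v] never uses the supposed chord, so the chord would be
       an edge of the cycle. *)
    apply: (bridge uq e).
    have [n vn] := next_iter_cycle uc uC vC.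
    rewrite [X in connect _ _ X]vn {vn}.
    have inc k : iter k (next c) u \in c by elim: k => //= k IH; rewrite mem_next.
    elim: n => [|n IH]; first exact: connect0.
    apply: connect_trans IH _; apply: connect1 => /=.
    set z := iter n _ u; rewrite (next_cycle cyc) ?inc //=.
    apply/negP => /eqP/setP hz.
    have := hz u; have := hz v; rewrite !inE !eqxx orbT /=.
    move=> /orP[/eqP vz|/eqP vz] /orP[/eqP uz|/eqP uz].
    * by move: e; rewrite uz vz edgexx.
    * by move: nu; rewrite uz vz eqxx.
    * by move: nv; rewrite uz vz eqxx.
    * by move: e; rewrite uz vz edgexx.
  case/imsetP => z zC /setP hz.
  have := hz u; have := hz v; rewrite !inE !eqxx orbT /=.
  move=> /esym/orP[/eqP vz|/eqP vz] /esym/orP[/eqP uz|/eqP uz].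
  + by move: e; rewrite uz vz edgexx.
  + by move: nu; rewrite uz vz eqxx.
  + by move: nv; rewrite uz vz eqxx.
  + by move: e; rewrite uz vz edgexx.
- move=> w A wc cA wA u v; rewrite !inE => /andP[uA wu] /andP[vA wv].
  apply/eqP; apply: contraT => uv.
  have : [set w; u] \in cycle_edges c.
    (* The walk goes from [w] to [v] and then inside [A], which avoids [w], to [u]. *)
    apply: (bridge uq wu).
    apply: (@connect_trans _ _ v).
      apply: connect1; rewrite /= wv; apply/negP => /eqP/setP/(_ v).
      rewrite !inE eqxx orbT => /esym/orP[]/eqP e.
        by rewrite -e vA in wA.
      by rewrite e eqxx in uv.
    apply: connect_sub (conn_connect cA vA uA) => x y /and3P[xA yA e].
    apply: connect1; rewrite /= e; apply/negP => /eqP/setP/(_ w).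
    rewrite !inE eqxx /= => /orP[]/eqP e'; by rewrite e' ?xA ?yA in wA.
  case/imsetP => z zC /setP/(_ w); rewrite !inE eqxx => /esym/orP[]/eqP e.
    by rewrite e zC in wc.
  by rewrite e mem_next zC in wc.
Qed.

End Unicyclic.

(** * Matched pairs around the cycle *)

Section Core.
Variable G : sgraph.
Implicit Types (A B C D S M K F X Z : {set G}) (u v w s : G) (c : seq G).

(** The preimage of a cut of [F] is a cut of the whole graph, and the image of an edge crossing it
    crosses the cut of [F]. The retractions used send leaves to supports and free cycle vertices to
    a remaining one. *)
Lemma conn_retract F (f : G -> G) : conn [set: G] ->
  (forall v, f v \in F) -> {in F, forall v, f v = v} ->
  (forall u v, u \notin F -> edge u v -> f u = f v \/ edge (f u) (f v)) -> conn F.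
Proof.
move=> cG fF idF fe B sBF /set0Pn[b bB] BnF.
have [||u [v []]] := cG (f @^-1: B) (subsetT _).
- by apply/set0Pn; exists b; rewrite inE idF // (subsetP sBF).
- apply: contraNneq BnF => /setP h; rewrite eqEsubset sBF; apply/subsetP => z zF.
  by have := h z; rewrite !inE idF.
rewrite !inE andbT => uB vB e; exists (f u), (f v); rewrite inE vB fF; split=> //.
have nE : f u <> f v by move=> h; rewrite -h uB in vB.
have [uF|uF] := boolP (u \in F); last by case: (fe u v uF e).
have [vF|vF] := boolP (v \in F); first by rewrite !idF.
have vu : edge v u by rewrite edgeC.
by case: (fe v u vF vu) => [/esym//|]; rewrite edgeC.
Qed.

Definition core c := [/\ uniq c, (3 <= size c)%N,
   {in c &, forall u v, edge u v = (v == next c u) || (u == next c v)} &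
   forall w A, w \notin c -> conn A -> w \notin A ->
     {in nb A w &, forall u v, u = v}].

Lemma nb_le1 A w : {in nb A w &, forall u v, u = v} -> (#|nb A w| <= 1)%N.
Proof. by move=> h; apply/card_le1_eqP => x y xA yA; apply: h. Qed.

Section Fixed.
Variables (c : seq G).
Hypothesis cc : core c.
Hypothesis cG : conn [set: G].

Let C := [set z in c].

Lemma core_next v : v \in c -> edge v (next c v).
Proof. by case: cc => _ _ ec _ vc; rewrite ec ?mem_next // eqxx. Qed.

Lemma core_conn : conn C.
Proof.
case: cc => uc _ ec _ A sA A0 An.
have [a aA na] := next_out uc A0 sA An.
have ac : a \in c by have := subsetP sA a aA; rewrite inE.
by exists a, (next c a); rewrite !inE na mem_next ac core_next.
Qed.

Lemma core_neq0 : C != set0.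
Proof.
case: cc => _ + _ _; rewrite /C; case: c => // x s _.
by apply/set0Pn; exists x; rewrite !inE eqxx.
Qed.

(** Noncut vertices outside [C] are peeled off the whole graph until one of them, [w], lies in [B].
    The connected set [S :\ w] then contains the rest of [B], and [w] has at most one neighbour in
    it. *)
Lemma core_degenerate B : C \subset B -> B != C ->
  exists2 w, w \in B :\: C & (#|nb B w| <= 1)%N.
Proof.
move: (subsetT B); have [n] := ubnP #|[set: G]|; move: cG; move: [set: G].
elim: n => // n IH S cS ltn sBS sCB nBC; move: IH.
have pCS : C \proper S.
  by rewrite properE (subset_trans sCB sBS) /=; apply: contra nBC => h;
     rewrite eqEsubset sCB andbT (subset_trans sBS h).
have [w [wS wC cSw]] := conn_noncut cS core_conn core_neq0 pCS => IH.
have [wB|wB] := boolP (w \in B); last first.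
  apply: (IH (S :\ w)) => //; last by rewrite subsetD1 sBS.
  by move: ltn; rewrite (cardsD1 w S) wS.
exists w; first by rewrite inE wC wB.
case: cc => _ _ _ br; have := br w (S :\ w) _ cSw.
rewrite !inE eqxx /= => /(_ _ isT) h.
have {}h : {in nb (S :\ w) w &, forall u v, u = v} by apply: h; move: wC; rewrite inE.
apply: leq_trans (nb_le1 h); apply: subset_leq_card; apply/subsetP => z.
rewrite !inE => /andP[zB e]; rewrite (subsetP sBS z zB) e !andbT.
by apply: contraTneq e => ->; rewrite edgexx.
Qed.

(** If [B] lies on the cycle, it is a proper part of it, and a vertex whose successor is missing has
    only its predecessor left. Otherwise [core_degenerate] applies to [B :|: C]. *)
Lemma core_forest s B : s \in C -> s \notin B -> B != set0 ->
  exists2 w, w \in B & (#|nb B w| <= 1)%N.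
Proof.
move=> sC sB B0; have [sBC|/subsetPn[z zB zC]] := boolP (B \subset C).
  case: cc => uc _ ec _.
  have [|a aB na] := next_out uc B0 sBC.
    by apply: contraNneq sB => ->.
  exists a => //; apply: leq_trans (_ : #|[set prev c a]| <= 1)%N; last by rewrite cards1.
  apply: subset_leq_card; apply/subsetP => u; rewrite !inE => /andP[uB].
  have inc v : v \in B -> v \in c by move/(subsetP sBC); rewrite inE.
  rewrite ec ?inc // => /orP[/eqP e|/eqP->]; first by rewrite -e uB in na.
  by rewrite prev_next.
have [|w] := @core_degenerate (B :|: C) (subsetUr _ _).
  by apply: contraNneq zC => <-; rewrite inE zB.
rewrite !inE => /andP[wC /orP[wB|wC']]; last by rewrite wC' in wC.
move=> h; exists w => //; apply: leq_trans h; apply: subset_leq_card.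
by apply/subsetP => v; rewrite !inE => /andP[-> ->].
Qed.

Lemma core_noiso : noiso [set: G].
Proof.
move=> v _; have [||u [w []]] := cG (subsetT [set v]).
- by apply/set0Pn; exists v; rewrite inE.
- have [_ sz _ _] := cc; have uc : uniq c by case: cc.
  apply/eqP => e; have := max_card (mem c); rewrite (card_uniqP uc) -cardsT -e cards1.
  by move: sz; clear; lia.
by rewrite !inE => /eqP-> _ e; apply/set0Pn; exists w; rewrite !inE.
Qed.

Section Matching.
Variables (m : G -> G) (k : nat).
Hypothesis mP : {in ~: C, forall v, [&& m v \in ~: C, m (m v) == v & edge v (m v)]}.
Hypothesis mc : forall M K, mis [set: G] M -> mis C K -> #|M|.*2 = (#|~: C| + #|K|.*2)%N.
Hypothesis kE : forall K, mis C K -> #|K| = k.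

Lemma ind_core_le S : independent S -> S \subset C -> (#|S| <= k)%N.
Proof.
by move=> iS sS; have [K /kE<- sSK] := mis_ext sS iS; apply: subset_leq_card.
Qed.

(** An independent set is disjoint from its image under [m], which has the same size. *)
Lemma ind_pairs_le S D : independent S -> S \subset D -> D \subset ~: C ->
  {in D, forall v, m v \in D} -> (#|S|.*2 <= #|D|)%N.
Proof.
move=> /indP iS sSD sDC mD.
have inC z : z \in S -> z \in ~: C by move/(subsetP sSD)/(subsetP sDC).
have inj : {in S &, injective m}.
  move=> u v /inC/mP/and3P[_ /eqP e1 _] /inC/mP/and3P[_ /eqP e2 _] e.
  by rewrite -e1 e e2.
rewrite -addnn -{2}(card_in_imset inj).
have -> : (#|S| + #|m @: S|)%N = #|S :|: m @: S|.
  rewrite cardsU (_ : S :&: m @: S = set0) ?cards0 ?subn0 //.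
  apply/setP => z; rewrite !inE; apply/negP => /andP[zS /imsetP[u uS e]].
  by have := iS u z uS zS; rewrite e; case/and3P: (mP (inC u uS)) => _ _ ->.
apply: subset_leq_card; rewrite subUset sSD; apply/subsetP => z /imsetP[u uS ->].
by apply: mD; apply: (subsetP sSD).
Qed.

(** The cycle contributes at most [k] vertices and each pair at most one; the prescribed total
    forces equality. *)
Lemma mis_core_card M : mis [set: G] M -> #|M :&: C| = k.
Proof.
move=> mM; have iM : independent M by case/and3P: mM.
have [K mK _] := @mis_ext G C set0 (sub0set _) (ind0 G).
have e := mc mM mK; rewrite (kE mK) in e.
have h1 := ind_core_le (ind_sub (subsetIl _ _) iM) (subsetIr M C).
have h2 : (#|M :\: C|.*2 <= #|~: C|)%N.
  apply: ind_pairs_le => //.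
  - exact: ind_sub (subsetDl _ _) iM.
  - by rewrite setDE subsetIr.
  - by move=> v /mP/and3P[].
by have := cardsID C M; move: e h1 h2; clear; lia.
Qed.

(** With one pair left out, the cycle and the remaining pairs cannot reach the prescribed total. *)
Lemma mis_hits_pairs M s : mis [set: G] M -> s \notin C -> (s \in M) || (m s \in M).
Proof.
move=> mM sC; have iM : independent M by case/and3P: mM.
apply: contraT; rewrite negb_or => /andP[sM msM].
have [K mK _] := @mis_ext G C set0 (sub0set _) (ind0 G).
have e := mc mM mK; rewrite (kE mK) in e.
have h1 := ind_core_le (ind_sub (subsetIl _ _) iM) (subsetIr M C).
have sC' : s \in ~: C by rewrite inE.
case/and3P: (mP sC') => msC /eqP mms es.
have nsm : s != m s by apply: contraTneq es => <-; rewrite edgexx.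
have h2 : (#|M :\: C|.*2 <= #|~: C :\ s :\ m s|)%N.
  apply: ind_pairs_le.
  - exact: ind_sub (subsetDl _ _) iM.
  - apply/subsetP => z; rewrite !inE => /andP[zC zM]; rewrite zC andbT.
    by apply/andP; split; apply: contraTneq zM => ->.
  - by apply: subset_trans (subsetDl _ _) (subsetDl _ _).
  - move=> v; rewrite !in_setD1 => /and3P[vms vs vC].
    case/and3P: (mP vC) => mvC /eqP mmv _; rewrite mvC andbT; apply/andP; split.
      by apply: contraNneq vs => e'; rewrite -mmv e' mms.
    by apply: contraNneq vms => e'; rewrite -mmv e'.
have := cardsID C M.
have : #|~: C| = #|~: C :\ s :\ m s|.+2.
  rewrite (cardsD1 s) (cardsD1 (m s) (_ :\ s)) sC' in_setD1 msC eq_sym nsm.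
  by rewrite !add1n.
by move: e h1 h2; clear; lia.
Qed.

(* Neighbours [a] of [s] and [b] of [m s] outside the pair are adjacent or equal,
   since otherwise a maximal independent set through them misses the pair; but
   then [s] lies on a cycle. *)
Lemma pair_leaf s : s \notin C -> (nb [set: G] s == [set m s]) || (nb [set: G] (m s) == [set s]).
Proof.
move=> sC; have sC' : s \in ~: C by rewrite inE.
case/and3P: (mP sC') => msC /eqP mms es.
have nsm : m s != s by apply: contraTneq es => ->; rewrite edgexx.
have other v w : edge v w -> nb [set: G] v != [set w] -> exists2 a, edge v a & a != w.
  move=> e; rewrite eqEsubset sub1set !inE e /= andbT => /subsetPn[a].
  by rewrite !inE /= => va aw; exists a.
apply: contraT; rewrite negb_or => /andP[n1 n2].
have [a sa ams] := other _ _ es n1.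
have [b mb bs] := other (m s) s ltac:(by rewrite edgeC) n2.
have as' : a != s by apply: contraTneq sa => ->; rewrite edgexx.
have bms : b != m s by apply: contraTneq mb => ->; rewrite edgexx.
have [_ _ _ br] := cc.
have sc : s \notin c by move: sC; rewrite inE.
have no A : conn A -> s \notin A -> a \in A -> m s \in A -> False.
  move=> cA sA aA mA; case/eqP: ams.
  by apply: (br s A sc cA sA); rewrite inE ?aA ?mA ?sa ?es.
have c1 : conn (b |: [set m s]).
  by apply: conn_setU1 (@conn_set1 G (m s)) _ mb; rewrite inE.
have s1 : s \notin b |: [set m s] by rewrite !inE negb_or eq_sym bs eq_sym.
have [ab|nab] := eqVneq a b.
  by case: (no _ c1 s1); rewrite !inE ?ab eqxx ?orbT.
have [eab|eab] := boolP (edge b a).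
  have c2 : conn (a |: (b |: [set m s])).
    by apply: conn_setU1 c1 _ eab; rewrite !inE eqxx.
  case: (no _ c2); rewrite ?inE ?eqxx ?orbT //.
  by rewrite negb_or eq_sym as'; move: s1; rewrite !inE.
have iab : independent [set a; b].
  apply/indP => u v; rewrite !inE => /orP[]/eqP-> /orP[]/eqP->; rewrite ?edgexx //.
  by rewrite edgeC.
have [M mM sM] := mis_ext (subsetT _) iab.
have [aM bM] : a \in M /\ b \in M by split; apply: (subsetP sM); rewrite !inE eqxx ?orbT.
case/orP: (mis_hits_pairs mM sC) => h.
  by have := mis_indep mM h aM; rewrite sa.
by have := mis_indep mM h bM; rewrite mb.
Qed.

Definition leaves := [set v in ~: C | nb [set: G] v == [set m v]].
Definition supports := ~: C :\: leaves.

Lemma leaf_edge l v : l \in leaves -> edge l v = (v == m l).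
Proof.
rewrite inE => /andP[_ /eqP/setP/(_ v)]; by rewrite !inE.
Qed.

Lemma support_mate v : v \in supports -> m v \in leaves.
Proof.
rewrite !in_setD inE => /andP[nl vC]; case/and3P: (mP vC) => mvC /eqP mmv _.
rewrite inE mvC mmv; move: nl; rewrite vC /= => nl.
by have := @pair_leaf v ltac:(by move: vC; rewrite inE); rewrite (negPf nl).
Qed.

(** Two mates that are both leaves would form a component of [G] disjoint from the cycle. *)
Lemma leaf_mate v : v \in leaves -> m v \in supports.
Proof.
move=> vL; have vC : v \in ~: C by move: vL; rewrite inE => /andP[].
case/and3P: (mP vC) => mvC /eqP mmv e.
rewrite in_setD mvC andbT; apply/negP => mL.
have [x xC] := set0Pn _ core_neq0.
have [||u [w []]] := cG (subsetT [set v; m v]).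
- by apply/set0Pn; exists v; rewrite !inE eqxx.
- apply: contraTneq xC => /setP/(_ x); rewrite !inE => /orP[]/eqP->.
    by move: vC; rewrite !inE.
  by move: mvC; rewrite !inE.
rewrite !inE negb_or andbT => uv /andP[wv wmv]; case/orP: uv => /eqP->.
  by rewrite (leaf_edge _ vL) (negPf wmv).
by rewrite (leaf_edge _ mL) mmv (negPf wv).
Qed.

Lemma supports_mP v : v \in supports -> m (m v) = v.
Proof. by rewrite in_setD => /andP[_ /mP/and3P[_ /eqP]]. Qed.

Lemma leaves_mP v : v \in leaves -> m (m v) = v.
Proof. by rewrite inE => /andP[/mP/and3P[_ /eqP]]. Qed.

Lemma card_supports : #|supports| = #|leaves|.
Proof.
apply/eqP; rewrite eqn_leq; apply/andP; split.
  have inj : {in supports &, injective m}.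
    by move=> u v /supports_mP e1 /supports_mP e2 e; rewrite -e1 e e2.
  rewrite -(card_in_imset inj); apply: subset_leq_card; apply/subsetP => z.
  by case/imsetP => v /support_mate vS ->.
have inj : {in leaves &, injective m}.
  by move=> u v /leaves_mP e1 /leaves_mP e2 e; rewrite -e1 e e2.
rewrite -(card_in_imset inj); apply: subset_leq_card; apply/subsetP => z.
by case/imsetP => v /leaf_mate vS ->.
Qed.

Lemma supports_core v : v \in supports -> v \notin c.
Proof. by rewrite !inE => /andP[_]. Qed.

Lemma leaves_core v : v \in leaves -> v \notin c.
Proof. by rewrite !inE => /andP[]. Qed.

Lemma leaves_supports v : v \in leaves -> v \notin supports.
Proof. by move=> vL; rewrite in_setD vL. Qed.

Lemma leaves_indep : {in leaves &, forall u v, ~~ edge u v}.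
Proof.
move=> u v uL vL; rewrite leaf_edge //; apply: contraTneq vL => ->.
by have := leaf_mate uL; rewrite in_setD => /andP[].
Qed.

Lemma core_leaf u l : u \in c -> l \in leaves -> edge u l = false.
Proof.
move=> uc lL; rewrite edgeC leaf_edge //; apply: contraTF uc => /eqP->.
exact/supports_core/leaf_mate.
Qed.

Lemma support_leaf u l : u \in supports -> l \in leaves ->
  (u != l) && (edge u l == (l == m u)).
Proof.
move=> uS lL; apply/andP; split.
  by apply: contraTneq uS => ->; apply: leaves_supports.
rewrite edgeC leaf_edge //; apply/eqP; apply/eqP/eqP => [->|->].
  by rewrite leaves_mP.
by rewrite supports_mP.
Qed.

Lemma in_parts v : [|| v \in supports, v \in leaves | v \in c].
Proof. by rewrite !inE; case: (v \in c); case: (_ == _). Qed.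

Definition attached v := [exists s in ~: C, edge v s].

(* A maximal independent set containing [Z] and, for each [x] in [X], a neighbour
   of [x] off the cycle, meets the cycle in [Z] only. *)
Lemma core_dominated X Z : X \subset C -> {in X, forall x, attached x} ->
  Z \subset C -> independent Z -> {in C, forall v, (v \in X) = ~~ [exists z in Z, v \in cN z]} ->
  (k <= #|Z|)%N.
Proof.
move=> sXC aX sZC iZ dom.
pose sx x := odflt x [pick s | (s \notin C) && edge x s].
have sxP x : x \in X -> sx x \notin C /\ edge x (sx x).
  move=> /aX/exists_inP[s sC xs]; rewrite /sx; case: pickP => [t /andP[]//|/(_ s)].
  by move: sC; rewrite !inE xs => ->.
have [_ _ _ br] := cc.
have inc v : (v \in C) = (v \in c) by rewrite inE.
have one x y w : w \notin C -> x \in C -> y \in C -> edge x w -> edge y w -> x = y.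
  move=> wC' xC yC xw yw; apply: (br w C) => //; first by rewrite -inc.
  - exact: core_conn.
  - by rewrite inE xC edgeC.
  - by rewrite inE yC edgeC.
have iT : independent (Z :|: sx @: X).
  (* Such an edge forces [x = z], because an outside vertex has one neighbour on the cycle; but
     vertices of [X] are not dominated by [Z]. *)
  have i1 x z : x \in X -> z \in Z -> ~~ edge z (sx x).
    move=> xX zZ; have [sC xs] := sxP x xX; apply/negP => e.
    have xz : x = z.
      by apply: one xs e => //; [apply: (subsetP sXC)|apply: (subsetP sZC)].
    have xC := subsetP sXC x xX.
    move: xX; rewrite (dom x xC) => /negP; apply.
    by apply/exists_inP; exists z => //; rewrite inE xz eqxx.
  apply/indP => u v; rewrite !inE => /orP[uZ|/imsetP[x xX ->]] /orP[vZ|/imsetP[y yX ->]].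
  - exact: (indP _ iZ).
  - exact: i1.
  - by rewrite edgeC i1.
  (* If two chosen neighbours were adjacent, [sx x] would have the two neighbours [x] and [sx y] in
     the connected set [sx y |: C]. *)
  - have [sC xs] := sxP x xX; have [tC yt] := sxP y yX; apply/negP => e.
    have yC := subsetP sXC y yX; have xC := subsetP sXC x xX.
    have cA : conn (sx y |: C) by apply: conn_setU1 core_conn yC yt.
    have : x = sx y.
      apply: (br (sx x) (sx y |: C)) => //.
      + by rewrite -inc.
      + rewrite inE negb_or sC andbT inE; apply: contraTneq e => ->.
        by rewrite edgexx.
      + by rewrite !inE -inc xC orbT edgeC.
      + by rewrite !inE eqxx.
    by move=> exy; rewrite -exy xC in tC.
have [M mM sM] := mis_ext (subsetT _) iT.
rewrite -(mis_core_card mM); apply: subset_leq_card; apply/subsetP => v.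
rewrite inE => /andP[vM vC].
have := dom v vC; case: exists_inP => [[z zZ]|_] /=.
  rewrite inE => /predU1P[->//|zv] _.
  have zM : z \in M by rewrite (subsetP sM) // inE zZ.
  by have := mis_indep mM zM vM; rewrite zv.
move=> vX; have [_ e] := sxP v vX.
have sM' : sx v \in M by rewrite (subsetP sM) // inE imset_f ?orbT.
by have := mis_indep mM vM sM'; rewrite e.
Qed.

End Matching.
End Fixed.
End Core.

(** * Length of the cycle and position of its attached vertices *)

Section Structure.
Variable G : sgraph.
Implicit Types (A B C D S M K F X Z : {set G}) (u v w s : G) (c : seq G) (p : nat -> G).

(* A cyclic numbering of [C], periodic so that rotations are shifts of [p]. *)
Definition coords g p C := [/\ forall i, p i \in C,
  forall i j, (p i == p j) = (i == j %[mod g]),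
  forall i j, edge (p i) (p j) = (j == i.+1 %[mod g]) || (i == j.+1 %[mod g]) &
  forall v, v \in C -> exists2 i, (i < g)%N & v = p i].

Lemma coords_shift g p C a : (0 < g)%N -> coords g p C -> coords g (fun i => p (a + i)%N) C.
Proof.
move=> g0 [pC pq pe ps]; split=> [i|i j|i j|v vC] //.
- by rewrite pq eqn_modDl.
- by rewrite pe -!addnS !eqn_modDl.
(* [a * g.-1] stands for [- a] modulo [g]. *)
have [j _ ->] := ps v vC; exists ((j + a * g.-1) %% g)%N; first by rewrite ltn_mod.
apply/eqP; rewrite pq modnDmr addnCA -mulnS prednK // addnC.
by rewrite modnMDl // addnC modnMDl.
Qed.

Lemma core_coords c : core c -> exists p, coords (size c) p [set z in c].
Proof.
case=> uc sz ec _; case: c uc sz ec => // x0 s; set c := x0 :: s => uc sz ec.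
have g0 : (0 < size c)%N by [].
have lt i : (i %% size c < size c)%N by rewrite ltn_mod.
have pc i : nth x0 c (i %% size c) \in c by rewrite mem_nth.
have nx i : next c (nth x0 c (i %% size c)) = nth x0 c (i.+1 %% size c).
  rewrite next_nth pc index_uniq //=; move: (lt i); rewrite -[i.+1]addn1 -modnDml addn1.
  move: (i %% size c)%N => j; rewrite /= ltnS leq_eqVlt => /orP[/eqP->|h].
    by rewrite modnn nth_default.
  by rewrite modn_small.
exists (fun i => nth x0 c (i %% size c)); split=> [i|i j|i j|v].
- by rewrite inE.
- by rewrite nth_uniq.
- by rewrite ec // !nx !nth_uniq.
- rewrite inE => vc; exists (index v c); first by rewrite index_mem.
  by rewrite modn_small ?index_mem // nth_index.
Qed.

Lemma coords_card g p C : (0 < g)%N -> coords g p C -> #|C| = g.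
Proof.
move=> g0 [pC pq _ ps]; have -> : C = [set p i | i : 'I_g].
  apply/setP => v; apply/idP/imsetP => [/ps[i lti ->]|[i _ ->]] //.
  by exists (Ordinal lti).
rewrite card_imset ?card_ord // => i j /eqP; rewrite pq !modn_small // => /eqP.
exact: val_inj.
Qed.

(* Trade [p 3] for [p 2] and [p 4] in a maximal independent set containing
   [p 0], [p 3] and [p 6]. *)
Lemma wc_core_lt8 g p C : coords g p C -> wc C -> (g < 8)%N.
Proof.
move=> [pC pq pe ps] wC; rewrite ltnNge; apply/negP => g8.
have md i : (i < 8)%N -> (i %% g = i)%N by move=> i8; rewrite modn_small // (leq_trans i8).
(* [p 0] and [p 6] keep [p 1] and [p 5] out of [M], so that the trade preserves independence. They
   are nonadjacent because [g] is at least [8]. *)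
have [M mM sM] := @mis_ext G C [set p 0; p 3; p 6]%N
  ltac:(by rewrite !subUset !sub1set !pC)
  ltac:(by apply/indP => u v; rewrite !inE -!orbA => /or3P[]/eqP-> /or3P[]/eqP->; rewrite pe !md).
have MC := mis_sub mM.
have [M0 M3 M6] : [/\ p 0 \in M, p 3 \in M & p 6 \in M].
  by split; apply: (subsetP sM); rewrite !inE eqxx ?orbT.
have M2 : p 2 \notin M by apply/negP => h; have := mis_indep mM h M3; rewrite pe !md.
have M4 : p 4 \notin M by apply/negP => h; have := mis_indep mM h M3; rewrite pe !md.
have M1 : p 1 \notin M by apply/negP => h; have := mis_indep mM h M0; rewrite pe !md.
have M5 : p 5 \notin M by apply/negP => h; have := mis_indep mM h M6; rewrite pe !md.
have nbr i u : u \in C -> edge (p i.+1) u -> u = p i \/ u = p i.+2.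
  move=> /ps[j _ ->]; rewrite pe => /orP[h|h]; [right|left]; apply/eqP.
    by rewrite pq.
  by rewrite pq eq_sym -(eqn_modDr 1) !addn1.
have iT : independent (p 2 |: (p 4 |: (M :\ p 3))).
  case/and3P: (mM) => _ iM _.
  rewrite !ind_setU1 (ind_sub (subsetDl _ _) iM) /=; apply/andP; split.
    apply/forall_inP => u; rewrite !inE => /andP[u3 uM]; apply/negP => e.
    case: (nbr 3 u (subsetP MC u uM) e) => eu; first by rewrite eu eqxx in u3.
    by rewrite eu (negPf M5) in uM.
  apply/forall_inP => u; rewrite !inE => /predU1P[->|/andP[u3 uM]]; first by rewrite pe !md.
  apply/negP => e.
  case: (nbr 1 u (subsetP MC u uM) e) => eu; last by rewrite eu eqxx in u3.
  by rewrite eu (negPf M1) in uM.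
have sT : p 2 |: (p 4 |: (M :\ p 3)) \subset C.
  by rewrite !subUset !sub1set !pC (subset_trans (subsetDl _ _) MC).
have [N mN sTN] := mis_ext sT iT.
have := wC _ _ mM mN; have := subset_leq_card sTN.
rewrite !cardsU1 !inE (negPf M2) (negPf M4) pq !md // !andbF /= (cardsD1 (p 3) M) M3.
by clear; lia.
Qed.

Lemma exists_in_set2 (P : pred G) u v : [exists z in [set u; v], P z] = P u || P v.
Proof.
apply/exists_inP/orP => [[z]|[h|h]].
- by rewrite !inE => /orP[]/eqP-> h; [left|right].
- by exists u; rewrite ?inE ?eqxx.
- by exists v; rewrite ?inE ?eqxx ?orbT.
Qed.

Lemma exists_in_set1 (P : pred G) u : [exists z in [set u], P z] = P u.
Proof.
apply/exists_inP/idP => [[z]|h]; first by rewrite inE => /eqP->.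
by exists u; rewrite ?inE.
Qed.

Section Cases.
Variables (c : seq G).
Hypothesis cc : core c.
Hypothesis cG : conn [set: G].
Let C := [set z in c].
Variables (m : G -> G) (k : nat).
Hypothesis mP : {in ~: C, forall v, [&& m v \in ~: C, m (m v) == v & edge v (m v)]}.
Hypothesis mc : forall M K, mis [set: G] M -> mis C K -> #|M|.*2 = (#|~: C| + #|K|.*2)%N.
Hypothesis kE : forall K, mis C K -> #|K| = k.

Let dominated := core_dominated cc mP mc kE.
Let core_le := ind_core_le kE.
Let att := attached c.

(** Rotated to [a = 0]: [q 2] and [q 5] dominate all of the heptagon but [q 0], whereas [q 0],
    [q 2], [q 4] show [3 <= k]. *)
Lemma heptagon_attached p a : coords 7 p C -> ~~ att (p a).
Proof.
move=> cp; rewrite -[a]addn0; have := @coords_shift 7 p C a isT cp.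
set q := fun i => _; rewrite -[p _]/(q 0%N); move: q => q [pC pq pe ps]; apply/negP => ap.
have k3 : (3 <= k)%N.
  have <- : #|q 0 |: [set q 2; q 4]|%N = 3%N by rewrite cardsU1 cards2 !inE !pq.
  apply: core_le; last by rewrite !subUset !sub1set !pC.
  by apply/indP => u v; rewrite !inE => /or3P[]/eqP-> /or3P[]/eqP->; rewrite pe.
suff : (k <= #|[set q 2; q 5]%N|)%N by rewrite cards2 pq; case: k k3 => [|[|[|]]].
apply: (dominated (X := [set q 0%N])).
- by rewrite sub1set.
- by move=> x; rewrite inE => /eqP->.
- by rewrite subUset !sub1set !pC.
- by apply/indP => u v; rewrite !inE => /orP[]/eqP-> /orP[]/eqP->; rewrite pe.
move=> v /ps[i lti ->]; rewrite exists_in_set2 !inE !pq !pe.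
by move: i lti; do 7!case=> //.
Qed.

(** Rotated to [a = 0]: [q 3] dominates all of the pentagon but [q 0] and [q 1], whereas [q 0] and
    [q 2] show [2 <= k]. *)
Lemma pentagon_attached p a : coords 5 p C -> ~~ (att (p a) && att (p a.+1)).
Proof.
move=> cp; rewrite -[a.+1]addn1 -[in X in X && _](addn0 a).
have := @coords_shift 5 p C a isT cp; set q := fun i => _.
rewrite -[p (a + 0)]/(q 0%N) -[p (a + 1)]/(q 1%N); move: q => q [pC pq pe ps]; apply/negP => /andP[a0 a1].
have k2 : (2 <= k)%N.
  have <- : #|[set q 0; q 2]%N| = 2%N by rewrite cards2 !pq.
  apply: core_le; last by rewrite !subUset !sub1set !pC.
  by apply/indP => u v; rewrite !inE => /orP[]/eqP-> /orP[]/eqP->; rewrite pe.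
suff : (k <= #|[set q 3]|)%N by rewrite cards1; case: k k2 => [|[|]].
apply: (dominated (X := [set q 0; q 1]%N)).
- by rewrite subUset !sub1set !pC.
- by move=> x; rewrite !inE => /orP[]/eqP->.
- by rewrite sub1set.
- by apply/indP => u v; rewrite !inE => /eqP-> /eqP->; rewrite pe.
move=> v /ps[i lti ->]; rewrite exists_in_set1 !inE !pq !pe.
by move: i lti; do 5!case=> //.
Qed.

(** If all three vertices were attached, [core_dominated] would hold with [Z] empty, whereas
    [1 <= k]. *)
Lemma triangle_attached p : coords 3 p C -> exists a, ~~ att (p a).
Proof.
move=> [pC pq pe ps].
have k1 : (1 <= k)%N.
  rewrite -(cards1 (p 0%N)); apply: core_le; last by rewrite sub1set.
  by apply/indP => u v; rewrite !inE => /eqP-> /eqP->; rewrite pe.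
have [/forall_inP h|] := boolP [forall v in C, att v]; last first.
  by rewrite negb_forall_in => /exists_inP[v /ps[i _ ->]]; exists i.
have : (k <= #|(set0 : {set G})|)%N.
  apply: (dominated (X := C)) => //; rewrite ?sub0set ?ind0 //.
  by move=> v vC; rewrite vC; apply/esym/exists_inP => -[z]; rewrite inE.
by rewrite cards0; case: k k1.
Qed.

(** Since no two consecutive vertices are attached, there are at most two attached ones, at distance
    two; a rotation moves them to [q 0] and [q 2]. *)
Lemma pentagon_shift p : coords 5 p C ->
  exists q, coords 5 q C /\ [&& ~~ att (q 1%N), ~~ att (q 3%N) & ~~ att (q 4%N)].
Proof.
move=> cp; have [_ pq _ _] := cp.
have n i := pentagon_attached i cp.
have e j : p (5 + j)%N = p j by apply/eqP; rewrite pq modnDl.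
set Q := exists q, _.
have sh a : [&& ~~ att (p (a + 1)%N), ~~ att (p (a + 3)%N) & ~~ att (p (a + 4)%N)] -> Q.
  by move=> h; exists (fun i => p (a + i)%N); split=> //; apply: coords_shift.
have /= s0 := sh 0%N; have /= s1 := sh 1%N; have /= s2 := sh 2%N.
have /= s3 := sh 3%N; have /= s4 := sh 4%N.
have /= n0 := n 0%N; have /= n1 := n 1%N; have /= n2 := n 2%N.
have /= n3 := n 3%N; have /= n4 := n 4%N.
rewrite -[(1 + 4)%N]/(5 + 0)%N e in s1; rewrite -[(2 + 3)%N]/(5 + 0)%N -[(2 + 4)%N]/(5 + 1)%N !e in s2.
rewrite -[(3 + 3)%N]/(5 + 1)%N -[(3 + 4)%N]/(5 + 2)%N !e in s3.
rewrite -[(4 + 1)%N]/(5 + 0)%N -[(4 + 3)%N]/(5 + 2)%N -[(4 + 4)%N]/(5 + 3)%N !e in s4.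
rewrite -[5%N]/(5 + 0)%N e in n4.
move: s0 s1 s2 s3 s4 n0 n1 n2 n3 n4; rewrite ?add0n.
rewrite -?[(1 + 1)%N]/2%N -?[(1 + 3)%N]/4%N -?[(2 + 1)%N]/3%N -?[(3 + 1)%N]/4%N.
move: (att (p 0%N)) (att (p 1%N)) (att (p 2%N)) (att (p 3%N)) (att (p 4%N)).
by do 5!case; move=> /= *; auto.
Qed.

End Cases.
End Structure.

(** * Reduction to a connected graph on [e.+1] vertices *)

Section Reduce.
Variables (G : sgraph) (R : fieldType).
Implicit Types (A B C D M K F X Z : {set G}) (u v w s : G) (p : nat -> G).
Variables (c : seq G).
Hypothesis cc : core c.
Hypothesis cG : conn [set: G].
Let C := [set z in c].
Variables (m : G -> G) (k : nat).
Hypothesis mP : {in ~: C, forall v, [&& m v \in ~: C, m (m v) == v & edge v (m v)]}.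
Hypothesis mc : forall M K, mis [set: G] M -> mis C K -> #|M|.*2 = (#|~: C| + #|K|.*2)%N.
Hypothesis kE : forall K, mis C K -> #|K| = k.

Let att := attached c.
Variables S L : {set G}.
Hypothesis sm : {in S, forall v, m v \in L}.
Hypothesis lm : {in L, forall v, m v \in S}.
Hypothesis smm : {in S, forall v, m (m v) = v}.
Hypothesis sC : forall v, v \in S -> v \notin c.
Hypothesis lC : forall v, v \in L -> v \notin c.
Hypothesis ls : forall v, v \in L -> v \notin S.
Hypothesis le : forall l v, l \in L -> edge l v = (v == m l).
Hypothesis lind : {in L &, forall u v, ~~ edge u v}.
Hypothesis cl : forall u l, u \in c -> l \in L -> edge u l = false.
Hypothesis sl : forall u l, u \in S -> l \in L -> (u != l) && (edge u l == (l == m u)).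
Hypothesis parts : forall v, [|| v \in S, v \in L | v \in c].
Hypothesis cSL : #|S| = #|L|.

(** In use, [e] counts the vertices summed out: the leaves together with one vertex of the triangle
    or two of the pentagon. *)
Definition reduces e F := [/\ #|G| = e.*2.+1, #|F| = e.+1, conn F &
  forall x : R, 1 + x != 0 -> ip [set: G] x = (1 + x) ^+ e * ip F (x / (1 + x))].

Lemma unattached_edge x v : ~~ att x -> v \notin c -> edge x v = false.
Proof.
move=> nx vc; apply: contraNF nx => e; apply/exists_inP; exists v => //.
by rewrite !inE.
Qed.

Lemma card_parts : #|G| = (#|C| + #|L|.*2)%N.
Proof.
have dSL : [disjoint S & L].
  by rewrite disjoint_sym disjoints_subset; apply/subsetP => v /ls; rewrite in_setC.
rewrite -(cardsC C) -addnn -{1}cSL; congr (_ + _)%N.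
rewrite -[RHS]subn0 -[in RHS](cards0 G) -(disjoint_setI0 dSL) -cardsU.
apply: eq_card => v; rewrite !inE.
case/or3P: (parts v) => [vS|vL|vc].
- by rewrite vS sC.
- by rewrite vL orbT lC.
- rewrite vc; apply/esym/negbTE; rewrite negb_or.
  by apply/andP; split; apply: contraL vc; [exact: sC|exact: lC].
Qed.

(** The unattached vertex, renamed [q 1], acts as a leaf whose neighbourhood is the clique of [q 0]
    and [q 2], so that [ip_whisker] applies with [q 1 |: L]. *)
Lemma triangle_reduces p : coords 3 p C -> exists e F, reduces e F.
Proof.
move=> cp; have [a na] := triangle_attached cc mP mc kE cp.
have p3 : p (a.+2 + 1)%N = p a.
  by have [_ pq _ _] := cp; apply/eqP; rewrite addn1 pq -[a.+3]addn3 modnDr.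
have := @coords_shift G 3 p C a.+2 isT cp; rewrite -p3 in na.
move: na; set q := fun i => p (a.+2 + i)%N; rewrite -[p _]/(q 1%N).
move: q => q n1 cq; have [qC qq qe qs] := cq.
have qc i : q i \in c by have := qC i; rewrite inE.
have inc v : v \in c -> [|| v == q 0%N, v == q 1%N | v == q 2%N].
  move=> vc; have [|i + ->] := qs v; first by rewrite inE.
  by rewrite !qq; case: i => [|[|[|]]].
have nS i : q i \notin S by apply: contraL (qc i) => /sC.
have nL i : q i \notin L by apply: contraL (qc i) => /lC.
pose F := S :|: [set q 0; q 2]%N; pose L' := q 1%N |: L.
pose lf v := if v \in S then m v else q 1%N.
have cF : #|F| = #|L|.+2.
  rewrite cardsU disjoint_setI0 ?cards0 ?subn0.
    by rewrite cards2 qq cSL addn2.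
  by rewrite disjoint_sym disjoints_subset subUset !sub1set !inE !nS.
have cL : #|L'| = #|L|.+1 by rewrite cardsU1 nL.
exists #|L'|, F; split.
- by rewrite card_parts (coords_card _ cq) // cL.
- by rewrite cF cL.
- apply: (@conn_retract _ _ (fun v => if v \in L then m v else if v == q 1%N then q 0%N else v)) => //.
  + move=> v; case: ifP => [/lm vS|vL]; first by rewrite inE vS.
    have [_|v1] := eqVneq v (q 1%N); first by rewrite !inE eqxx orbT.
    case/or3P: (parts v) => [vS|vL'|/inc/or3P[]/eqP e].
    * by rewrite inE vS.
    * by rewrite vL' in vL.
    * by rewrite e !inE eqxx orbT.
    * by rewrite e eqxx in v1.
    * by rewrite e !inE eqxx !orbT.
  + move=> v; rewrite !inE => /or3P[vS|/eqP->|/eqP->]; rewrite ?(negPf (nL _)) ?qq //.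
    have /negPf-> : v \notin L by apply: contraL vS => /ls.
    by have /negPf-> : v != q 1%N by apply: contraTneq vS => ->; apply: nS.
  + move=> u v uF e; case/or3P: (parts u) => [uS|uL|/inc/or3P[]/eqP eu].
    * by rewrite inE uS in uF.
    * have /eqP ev : v == m u by rewrite -(le v uL).
      left; rewrite uL ev; have mS := lm uL.
      have /negPf-> : m u \notin L by apply: contraL mS => /ls.
      by have /negPf-> : m u != q 1%N by apply: contraTneq mS => ->; apply: nS.
    * by rewrite eu !inE eqxx orbT in uF.
    * rewrite eu (negPf (nL 1%N)) eqxx.
      have vc : v \in c by apply: contraTT e => vc; rewrite eu unattached_edge.
      case/inc/or3P: vc => /eqP ev; rewrite ev ?(negPf (nL _)) ?qq /=.
      - by left.
      - by left.
      - by right; rewrite qe.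
    * by rewrite eu !inE eqxx !orbT in uF.
- move=> x x1; have -> : [set: G] = F :|: L'.
    apply/setP => v; rewrite !inE; apply/esym.
    case/or3P: (parts v) => [->//|->|/inc/or3P[]->]; rewrite ?orbT //.
  have F2 u : u \in F -> u \in S \/ u \notin S /\ (u = q 0%N \/ u = q 2%N).
    by rewrite !inE => /or3P[->|/eqP->|/eqP->]; [left|right|right]; rewrite ?nS; intuition.
  apply: (@ip_whisker _ _ _ _ lf).
  + by [].
  + move=> u v /setU1P[->|uL] /setU1P[->|vL].
    * by rewrite edgexx.
    * by rewrite cl.
    * by rewrite edgeC cl.
    * exact: lind.
  + move=> u v /F2[uS|[uS uq]] /setU1P[->|vL]; rewrite /lf.
    * rewrite uS edgeC unattached_edge ?sC //.
      have /negPf-> : q 1%N != m u.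
        by apply: contraNneq (nL 1%N) => ->; apply: sm.
      by rewrite andbT; apply: contraTneq uS => ->.
    * by rewrite uS sl.
    * by rewrite (negPf uS) eqxx; case: uq => ->; rewrite qe qq.
    * rewrite (negPf uS); have /negPf-> : v != q 1%N.
        by apply: contraTneq vL => ->.
      by case: uq => ->; rewrite cl // andbT; apply: contraTneq vL => <-.
  + move=> u /F2[uS|[uS _]]; rewrite /lf !inE; first by rewrite uS sm ?orbT.
    by rewrite (negPf uS) eqxx.
  + move=> u v /F2[uS|[uS uq]] /F2[vS|[vS vq]]; rewrite /lf ?uS ?vS ?(negPf uS) ?(negPf vS).
    * by move=> e /negP[]; rewrite -(smm uS) e smm.
    * by move=> e; have := sm uS; rewrite e (negPf (nL _)).
    * by move=> e; have := sm vS; rewrite -e (negPf (nL _)).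
    * by case: uq => ->; case: vq => ->; rewrite ?eqxx // qe.
Qed.

Lemma pentagon_reduces p : coords 5 p C -> exists e F, reduces e F.
Proof.
move=> cp; have [q [cq /and3P[n1 n3 n4]]] := pentagon_shift cc mP mc kE cp.
have [qC qq qe qs] := cq.
have qc i : q i \in c by have := qC i; rewrite inE.
have inc v : v \in c -> v \in [:: q 0; q 1; q 2; q 3; q 4]%N.
  move=> vc; have [|i + ->] := qs v; first by rewrite inE.
  by rewrite !inE !qq; case: i => [|[|[|[|[|]]]]].
have nS i : q i \notin S by apply: contraL (qc i) => /sC.
have nL i : q i \notin L by apply: contraL (qc i) => /lC.
pose F := S :|: [set z in [:: q 0; q 1; q 2]%N].
have cF : #|F| = #|L|.+3.
  rewrite cardsU disjoint_setI0 ?cards0 ?subn0.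
    rewrite cardsE (card_uniqP _) /= ?inE ?qq //.
    by rewrite cSL addn3.
  rewrite disjoint_sym disjoints_subset; apply/subsetP => z.
  by rewrite !inE => /or3P[]/eqP->; rewrite nS.
exists #|L|.+2, F; split.
- by rewrite card_parts (coords_card _ cq) // !doubleS.
- by rewrite cF.
(* [q 3] and [q 4] both go to [q 1]: the edges to [q 2] and [q 0] become those of [q 1], and the
   edge between them collapses. *)
- apply: (@conn_retract _ _ (fun v => if v \in L then m v else if v \in [:: q 3; q 4]%N then q 1%N else v)) => //.
  + move=> v; case: ifP => [/lm vS|vL]; first by rewrite inE vS.
    case: ifP => [_|v34]; first by rewrite !inE eqxx !orbT.
    case/or3P: (parts v) => [vS|vL'|/inc]; first by rewrite inE vS.
      by rewrite vL' in vL.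
    by move: v34; rewrite !inE => /norP[/negPf-> /negPf->]; rewrite !orbF => ->; rewrite orbT.
  + move=> v; rewrite in_setU => /orP[vS|].
      have /negPf-> : v \notin L by apply: contraL vS => /ls.
      have /negPf-> // : v \notin [:: q 3; q 4]%N.
      by apply: contraL vS; rewrite !inE => /orP[]/eqP->; apply: nS.
    by rewrite !inE => /or3P[]/eqP->; rewrite ?(negPf (nL _)) ?qq.
  + move=> u v uF e; case/or3P: (parts u) => [uS|uL|uc].
    * by rewrite inE uS in uF.
    * have /eqP ev : v == m u by rewrite -(le v uL).
      left; rewrite uL ev; have mS := lm uL.
      have /negPf-> : m u \notin L by apply: contraL mS => /ls.
      have /negPf-> // : m u \notin [:: q 3; q 4]%N.
      by apply: contraL mS; rewrite !inE => /orP[]/eqP->; apply: nS.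
    * have u34 : (u == q 3%N) || (u == q 4%N).
        by move: (inc u uc) uF; rewrite !inE => /predU1P[->|/or4P[]->]; rewrite ?eqxx ?orbT.
      have natt : ~~ att u by case/orP: u34 => /eqP->.
      have /inc vc : v \in c by apply: contraTT e => vc; rewrite unattached_edge.
      have /negPf-> : u \notin L by apply: contraL uc => /lC.
      rewrite !inE u34; move: vc e; rewrite !inE.
      by case/orP: u34 => /eqP-> /predU1P[->|/or4P[]/eqP->];
        rewrite ?(negPf (nL _)) ?qq ?qe //=; by [left|right].
- move=> x x1; have -> : [set: G] = S :|: L :|: [set z in [:: q 0; q 1; q 2; q 3; q 4]%N].
    apply/setP => v; rewrite !inE; apply/esym.
    by case/or3P: (parts v) => [->//|->|/inc]; rewrite ?orbT // !inE => ->; rewrite orbT.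
  apply: (@ip_five _ _ _ _ m).
  + exact: x1.
  + exact: lind.
  + by move=> u v; apply: sl.
  + by move=> u; apply: sm.
  + by move=> u v uS vS e /negP[]; rewrite -(smm uS) e smm.
  + by rewrite /= !inE !qq.
  + by move=> z; rewrite !inE => /predU1P[->|/or4P[]/eqP->]; rewrite nS nL.
  + by rewrite !qe.
  + by rewrite !qe.
  + move=> z; rewrite !inE => /orP zSL.
    have zc : z \notin c by case: zSL => [/sC|/lC].
    by rewrite !unattached_edge.
  + by move=> z zL; rewrite !cl.
Qed.

(** No vertex of the heptagon is attached, so by connectedness the cycle is the whole graph. *)
Lemma heptagon_ip p : coords 7 p C -> #|G| = 7%N /\
  forall x : R, ip [set: G] x = pathv x 7 + x * pathv x 5.
Proof.
move=> cp; have [pC pq pe ps] := cp.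
have CT : C = [set: G].
  apply/eqP; apply: contraT => Cn; have [u [v []]] := cG (subsetT C) (core_neq0 cc) Cn.
  move=> uC; rewrite !inE andbT => vc e; have [i _ ui] := ps u uC.
  have := heptagon_attached cc mP mc kE i cp; rewrite -ui => /unattached_edge.
  by move/(_ v vc); rewrite e.
have cardG : #|G| = 7%N by rewrite -cardsT -CT (coords_card _ cp).
split=> // x.
pose pos v : nat := odflt ord0 [pick i : 'I_7 | p i == v].
have posP v : p (pos v) = v.
  rewrite /pos; case: pickP => [i /eqP//|h].
  have [|i lti vi] := ps v; first by rewrite CT.
  by have := h (Ordinal lti); rewrite /= vi eqxx.
apply: (@ip_cycle _ _ pos 4) => //.
- by move=> v; rewrite /pos ltn_ord.
- by move=> u v e; rewrite -(posP u) e posP.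
- move=> u v; rewrite -{1}(posP u) -{1}(posP v) pe.
  by rewrite !(modn_small (ltn_ord _)).
Qed.

End Reduce.

Lemma well_covered_unicyclic_reduces (R : fieldType) (G : sgraph) : odd #|G| ->
  graph_connected G -> well_covered G -> unicyclic G ->
  (exists e F, @reduces G R e F) \/
  (#|G| = 7%N /\ forall x : R, ip [set: G] x = pathv x 7 + x * pathv x 5).
Proof.
move=> oG cG wG uG; have [c cc] := unicyclic_core cG uG.
have {}cc : core c := cc; have {}cG := conn_setT cG.
set C := [set z in c].
have [||||||m [mP wC oC mc]] := @wc_core_matching G C [set: G].
- exact: core_degenerate.
- exact: core_forest.
- exact: subsetT.
- exact: well_covered_wc.
- exact: core_noiso cc cG.
- by rewrite cardsT.
rewrite setTD in mP mc.
have [K0 mK0 _] := @mis_ext G C set0 (sub0set _) (ind0 G).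
have kE K : mis C K -> #|K| = #|K0| by move=> mK; apply: wC.
have [p cp] := core_coords cc.
have g8 := wc_core_lt8 cp wC.
have [_ g3 _ _] := cc.
have : [\/ size c = 3%N, size c = 5%N | size c = 7%N].
  have sc : #|C| = size c by apply: coords_card cp; apply: leq_trans g3.
  move: oC g3 g8; rewrite sc; case: (size c) => [|[|[|[|[|[|[|[|]]]]]]]] // _ _ _.
  - by constructor 1.
  - by constructor 2.
  - by constructor 3.
case=> e; rewrite e in cp.
- left; apply: (triangle_reduces R cc cG mP mc kE (support_mate cc mP mc kE)
    (leaf_mate cc cG mP) (supports_mP mP) (@supports_core G c m) (@leaves_core G c m)
    (@leaves_supports G c m) (@leaf_edge G c m) (leaves_indep cc cG mP)
    (core_leaf cc cG mP) (support_leaf mP) (in_parts c m)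
    (card_supports cc cG mP mc kE) cp).
- left; apply: (pentagon_reduces R cc cG mP mc kE (support_mate cc mP mc kE)
    (leaf_mate cc cG mP) (supports_mP mP) (@supports_core G c m) (@leaves_core G c m)
    (@leaves_supports G c m) (@leaf_edge G c m) (leaves_indep cc cG mP)
    (core_leaf cc cG mP) (support_leaf mP) (in_parts c m)
    (card_supports cc cG mP mc kE) cp).
- by right; apply: (heptagon_ip R cc cG mP mc kE cp).
Qed.

Section Iso.
Variables (G H : sgraph) (f : H -> G).
Hypothesis bf : bijective f.
Hypothesis ef : forall u v, edge (f u) (f v) = edge u v.

Lemma ip_iso (R : comNzRingType) (x : R) : ip [set: H] x = ip [set: G] x.
Proof.
have [h fh hf] := bf; have fi := bij_inj bf.
rewrite /ip [RHS](reindex (fun S : {set H} => f @: S)) /=; last first.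
  exists (fun S : {set G} => h @: S) => S _; rewrite -imset_comp.
    by rewrite (eq_imset _ (_ : h \o f =1 id)) ?imset_id.
  by rewrite (eq_imset _ (_ : f \o h =1 id)) ?imset_id.
apply: eq_big => [S|S _]; last by rewrite card_imset.
rewrite !subsetT /=; apply/indP/indP => iS u v.
  by case/imsetP=> a aS -> /imsetP[b bS ->]; rewrite ef iS.
by move=> uS vS; rewrite -ef iS // imset_f.
Qed.

Lemma card_iso : #|H| = #|G|.
Proof. exact: bij_eq_card bf. Qed.

End Iso.

Lemma card_le_pos (T : finType) (A : {set T}) (pos : T -> nat) N :
  {in A, forall v, (pos v < N)%N} -> {in A &, injective pos} -> (#|A| <= N)%N.
Proof.
case: N => [|N] ltp inj.
  rewrite leqn0 cards_eq0 -subset0; apply/subsetP => v /ltp.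
  by rewrite ltn0.
have inj' : {in A &, injective (fun v => inord (pos v) : 'I_N.+1)}.
  move=> u v uA vA /(congr1 val); rewrite /= !inordK ?ltp //; exact: inj.
by rewrite -(card_in_imset inj') -[leqRHS]card_ord max_card.
Qed.

(** * The graphs of S_P *)

Section Members.
Variables (g k l : nat).
Let T := GP g k l.

(* Tag 0: cycle; 1 and 2: path and pendant vertices of the copy at [c_1]; 3 and 4:
   those of the copy at [c_3]. *)
Definition gpn (v : T) : nat * nat :=
  match v with
  | inl c => (0, nat_of_ord c)
  | inr (inl (inl i)) => (1, nat_of_ord i)
  | inr (inl (inr i)) => (2, nat_of_ord i)
  | inr (inr (inl j)) => (3, nat_of_ord j)
  | inr (inr (inr j)) => (4, nat_of_ord j)
  end%N.

(** Adjacency in terms of the numbers of [gpn], which turns the verifications on [GP] into case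
    analysis and linear arithmetic. *)
Definition gpr (a b : nat * nat) : bool :=
  match a, b with
  | (0, i), (0, j) => (i != j) && ((j == i.+1 %% g) || (i == j.+1 %% g))
  | (1, i), (1, j) | (3, i), (3, j) => (j == i.+1) || (i == j.+1)
  | (1, i), (2, j) | (2, i), (1, j) | (3, i), (4, j) | (4, i), (3, j) => i == j
  | (0, i), (1, j) => (i == 0) && (j == 0)
  | (1, j), (0, i) => (i == 0) && (j == 0)
  | (0, i), (3, j) => (i == 2) && (j == 0)
  | (3, j), (0, i) => (i == 2) && (j == 0)
  | _, _ => false
  end%N.

Lemma gpn_inj : injective gpn.
Proof.
by case=> [a|[[a|a]|[a|a]]] [b|[[b|b]|[b|b]]] //= [/val_inj->].
Qed.

Lemma gp_edge (u v : T) : edge u v = gpr (gpn u) (gpn v).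
Proof.
have -> : edge u v = (u != v) && edge u v.
  by case: eqVneq => [->|//]; rewrite edgexx.
rewrite -(inj_eq gpn_inj).
have n1 (A B : eqType) (a b : A) : ((inl a : A + B)%type == inl b) = (a == b).
  by apply/eqP/eqP => [[]|->].
have n2 (A B : eqType) (a b : B) : ((inr a : A + B)%type == inr b) = (a == b).
  by apply/eqP/eqP => [[]|->].
case: u => [a|[[a|a]|[a|a]]]; case: v => [b|[[b|b]|[b|b]]];
by rewrite /edge /= /sym_irrefl_closure /= ?n1 ?n2 ?n1 ?n2 ?n1 ?n2 ?xpair_eqE /=
  -?val_eqE /=; lia.
Qed.

Lemma gpn_bound (v : T) : let: (t, i) := gpn v in
  (t < 5)%N && (i < match t with 0 => g | 1 | 2 => k | _ => l end)%N.
Proof. by case: v => [a|[[a|a]|[a|a]]] /=; apply: ltn_ord. Qed.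

Lemma card_GP : #|T| = (g + (k + l).*2)%N.
Proof. by rewrite !card_sum !card_ord -!addnn addnACA. Qed.

Definition gp_leaf (v : T) : T :=
  match v with
  | inr (inl (inl i)) => inr (inl (inr i))
  | inr (inr (inl i)) => inr (inr (inr i))
  | _ => v
  end.

Lemma gpn_leaf (v : T) :
  gpn (gp_leaf v) = let: (t, i) := gpn v in (if (t == 1) || (t == 3) then t.+1 else t, i)%N.
Proof. by case: v => [a|[[a|a]|[a|a]]]. Qed.

End Members.

Section MembersIp.
Variables (R : fieldType) (k l : nat) (x : R).
Hypothesis x1 : 1 + x != 0.

Lemma ip_GP3 : ip [set: GP 3 k l] x =
  (1 + x) ^+ (k + l).+1 * pathv (x / (1 + x)) (k + l).+3.
Proof.
set T := GP 3 k l.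
pose inB (v : T) := let: (t, i) := gpn v in [|| t == 1, t == 3 | (t == 0) && (i != 1)]%N.
(* [L] consists of the pendant vertices and of [c_2], whose neighbours [c_1] and [c_3] form a
   clique. *)
pose B := [set v | inB v]; pose L := [set v | ~~ inB v].
pose c1 : T := inl (Ordinal (isT : 1 < 3)%N).
pose lf (v : T) := if v is inl _ then c1 else gp_leaf v.
(* Order along the path [B]: the first copy backwards, [c_1] at [k], [c_3] at [k + 1], then the
   second copy; [i./2] sends [0] and [2] to [0] and [1]. *)
pose pos (v : T) : nat := match gpn v with
  | (0, i) => k + i./2 | (1, i) => k.-1 - i | (_, j) => k.+2 + j end%N.
pose posL (v : T) : nat := match gpn v with
  | (0, i) => k + l | (2, i) => i | (_, j) => k + j end%N.
have gpn_lf v : gpn (lf v) = match gpn v with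
    | (0, _) => (0, 1) | (1, i) => (2, i) | (3, i) => (4, i) | a => a end%N.
  by case: v => [a|[[a|a]|[a|a]]].
have BL : B :|: L = [set: T] by apply/setP => v; rewrite !inE orbN.
have memB v : (v \in B) = inB v by rewrite inE.
have memL v : (v \in L) = ~~ inB v by rewrite inE.
have lpos : {in B, forall v, (pos v < (k + l).+2)%N}.
  by move=> v; rewrite memB /inB /pos; have := gpn_bound v; case: (gpn v) => [[|[|[|[|[|]]]]] i] //=; lia.
have ipos : {in B &, injective pos}.
  move=> u v; rewrite !memB /inB /pos => hu hv e; apply: gpn_inj; move: hu hv e.
  move: (gpn_bound u) (gpn_bound v).
  by case: (gpn u) => [[|[|[|[|[|]]]]] i] //=; case: (gpn v) => [[|[|[|[|[|]]]]] j] //=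
    => h1 h2 h3 h4 e; apply/eqP; rewrite xpair_eqE /=; lia.
have lposL : {in L, forall v, (posL v < (k + l).+1)%N}.
  by move=> v; rewrite memL /inB /posL; have := gpn_bound v; case: (gpn v) => [[|[|[|[|[|]]]]] i] //=; lia.
have iposL : {in L &, injective posL}.
  move=> u v; rewrite !memL /inB /posL => hu hv e; apply: gpn_inj; move: hu hv e.
  move: (gpn_bound u) (gpn_bound v).
  by case: (gpn u) => [[|[|[|[|[|]]]]] i] //=; case: (gpn v) => [[|[|[|[|[|]]]]] j] //=
    => h1 h2 h3 h4 e; apply/eqP; rewrite xpair_eqE /=; lia.
have [cB cL] : #|B| = (k + l).+2 /\ #|L| = (k + l).+1.
  (* The numberings only bound the two sizes from above, but the bounds add up to the order of the
     graph. *)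
  have h1 := card_le_pos lpos ipos; have h2 := card_le_pos lposL iposL.
  have := (cardsU B L : _ = _); rewrite BL cardsT card_GP.
  by move: h1 h2; clear; lia.
rewrite -BL (@ip_whisker _ _ _ _ lf) //.
- rewrite cL (@ip_path _ _ _ pos (k + l).+2) // => u v; rewrite !memB /inB /pos gp_edge.
  move: (gpn_bound u) (gpn_bound v).
  by case: (gpn u) => [[|[|[|[|[|]]]]] i] //=; case: (gpn v) => [[|[|[|[|[|]]]]] j] //=; lia.
- move=> u v; rewrite !memL /inB gp_edge.
  move: (gpn_bound u) (gpn_bound v).
  by case: (gpn u) => [[|[|[|[|[|]]]]] i] //=; case: (gpn v) => [[|[|[|[|[|]]]]] j] //=; lia.
- move=> u v; rewrite memB memL /inB gp_edge -!(inj_eq (@gpn_inj _ _ _)) gpn_lf.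
  move: (gpn_bound u) (gpn_bound v).
  by case: (gpn u) => [[|[|[|[|[|]]]]] i] //=; case: (gpn v) => [[|[|[|[|[|]]]]] j] //=;
    rewrite !xpair_eqE /=; lia.
- move=> u; rewrite memB memL /inB gpn_lf; move: (gpn_bound u).
  by case: (gpn u) => [[|[|[|[|[|]]]]] i].
- move=> u v; rewrite !memB /inB gp_edge => hu hv e.
  move: (congr1 (@gpn _ _ _) e) hu hv; rewrite !gpn_lf -(inj_eq (@gpn_inj _ _ _)).
  move: (gpn_bound u) (gpn_bound v).
  by case: (gpn u) => [[|[|[|[|[|]]]]] i] //=; case: (gpn v) => [[|[|[|[|[|]]]]] j] //=
    => h1 h2 /eqP; rewrite !xpair_eqE /=; lia.
Qed.

Lemma ip_GP5 : ip [set: GP 5 k l] x =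
  (1 + x) ^+ (k + l).+2 * pathv (x / (1 + x)) (k + l).+4.
Proof.
set T := GP 5 k l.
pose tagP (P : pred nat) := [set v : T | P (gpn v).1].
pose S := tagP (fun t => (t == 1) || (t == 3))%N.
pose L := tagP (fun t => (t == 2) || (t == 4))%N.
pose c0 : T := inl (Ordinal (isT : 0 < 5)%N); pose c1 : T := inl (Ordinal (isT : 1 < 5)%N).
pose c2 : T := inl (Ordinal (isT : 2 < 5)%N); pose c3 : T := inl (Ordinal (isT : 3 < 5)%N).
pose c4 : T := inl (Ordinal (isT : 4 < 5)%N).
pose F := S :|: [set z in [:: c0; c1; c2]].
(* Order along the path [F]: the first copy backwards, then [c_1], [c_2], [c_3], then the second
   copy. *)
pose pos (v : T) : nat := match gpn v with
  | (0, i) => k + i | (1, i) => k.-1 - i | (_, j) => k.+3 + j end%N.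
pose posL (v : T) : nat := match gpn v with
  | (2, i) => i | (_, j) => k + j end%N.
have eqn (u v : T) : (u == v) = (gpn u == gpn v) by rewrite (inj_eq (@gpn_inj _ _ _)).
have memS v : (v \in S) = ((gpn v).1 == 1%N) || ((gpn v).1 == 3%N) by rewrite inE.
have memL v : (v \in L) = ((gpn v).1 == 2%N) || ((gpn v).1 == 4%N) by rewrite inE.
have memF v : (v \in F) = [|| (gpn v).1 == 1, (gpn v).1 == 3 | ((gpn v).1 == 0) && ((gpn v).2 < 3)]%N.
  rewrite inE memS !inE !eqn /=; case: (gpn v) => t i; rewrite !xpair_eqE /=.
  by lia.
have SLC : S :|: L :|: [set z in [:: c0; c1; c2; c3; c4]] = [set: T].
  apply/setP => v; rewrite !in_setU memS memL !inE !eqn /=.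
  move: (gpn_bound v); case: (gpn v) => t i; rewrite !xpair_eqE /=.
  by case: t => [|[|[|[|[|]]]]] //=; lia.
have lpos : {in F, forall v, (pos v < (k + l).+3)%N}.
  by move=> v; rewrite memF /pos; have := gpn_bound v; case: (gpn v) => [[|[|[|[|[|]]]]] i] //=; lia.
have ipos : {in F &, injective pos}.
  move=> u v; rewrite !memF /pos => hu hv e; apply: gpn_inj; move: hu hv e.
  move: (gpn_bound u) (gpn_bound v).
  by case: (gpn u) => [[|[|[|[|[|]]]]] i] //=; case: (gpn v) => [[|[|[|[|[|]]]]] j] //=
    => h1 h2 h3 h4 e; apply/eqP; rewrite xpair_eqE /=; lia.
have lposL : {in L, forall v, (posL v < k + l)%N}.
  by move=> v; rewrite memL /posL; have := gpn_bound v; case: (gpn v) => [[|[|[|[|[|]]]]] i] //=; lia.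
have iposL : {in L &, injective posL}.
  move=> u v; rewrite !memL /posL => hu hv e; apply: gpn_inj; move: hu hv e.
  move: (gpn_bound u) (gpn_bound v).
  by case: (gpn u) => [[|[|[|[|[|]]]]] i] //=; case: (gpn v) => [[|[|[|[|[|]]]]] j] //=
    => h1 h2 h3 h4 e; apply/eqP; rewrite xpair_eqE /=; lia.
have [cF cL] : #|F| = (k + l).+3 /\ #|L| = (k + l)%N.
  have h1 := card_le_pos lpos ipos; have h2 := card_le_pos lposL iposL.
  have e : F :|: (L :|: [set c3; c4]) = [set: T].
    apply/setP => v; rewrite -SLC !inE.
    by rewrite -!orbA; do !bool_congr.
  have h3 := leq_card_setU F (L :|: [set c3; c4]).
  have h4 := leq_card_setU L [set c3; c4].
  have h5 : (#|[set c3; c4]| <= 2)%N by rewrite cards2; case: (_ == _).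
  have := cardsT T; rewrite card_GP -e.
  by move: h1 h2 h3.1 h4.1 h5; clear; lia.
rewrite -SLC (@ip_five _ _ _ _ (@gp_leaf _ _ _)) //.
- rewrite cL (@ip_path _ _ _ pos (k + l).+3) // => u v; rewrite !memF /pos gp_edge.
  move: (gpn_bound u) (gpn_bound v).
  by case: (gpn u) => [[|[|[|[|[|]]]]] i] //=; case: (gpn v) => [[|[|[|[|[|]]]]] j] //=; lia.
- move=> u v; rewrite !memL gp_edge.
  by case: (gpn u) => [[|[|[|[|[|]]]]] i] //=; case: (gpn v) => [[|[|[|[|[|]]]]] j].
- move=> u v; rewrite memS memL gp_edge !eqn gpn_leaf.
  by case: (gpn u) => [[|[|[|[|[|]]]]] i] //=; case: (gpn v) => [[|[|[|[|[|]]]]] j] //=;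
    rewrite !xpair_eqE /=; lia.
- move=> u; rewrite memS memL gpn_leaf.
  by case: (gpn u) => [[|[|[|[|[|]]]]] i].
- move=> u v; rewrite !memS gp_edge => hu hv e.
  move: (congr1 (@gpn _ _ _) e) hu hv; rewrite !gpn_leaf eqn.
  by case: (gpn u) => [[|[|[|[|[|]]]]] i] //=; case: (gpn v) => [[|[|[|[|[|]]]]] j] //=
    => /eqP; rewrite !xpair_eqE /=; lia.
- by move=> z; rewrite memS memL !inE => /predU1P[->|/or4P[]/eqP->].
- move=> z; rewrite inE memS memL !gp_edge.
  by case: (gpn z) => [[|[|[|[|[|]]]]] j].
- move=> z; rewrite memL !gp_edge.
  by case: (gpn z) => [[|[|[|[|[|]]]]] j].
Qed.

End MembersIp.

(** The value depends on [k] and [l] through [k + l] only, which is [e - 1] for the triangle and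
    [e - 2] for the pentagon. *)
Lemma in_SP_ip (R : fieldType) (H : sgraph) e (x : R) : in_SP H -> #|H| = e.*2.+1 ->
  1 + x != 0 -> ip [set: H] x = (1 + x) ^+ e * pathv (x / (1 + x)) e.+2.
Proof.
case=> g [k [l [gE _ [f [bf ef]]]]] cH x1.
have := card_iso bf; rewrite cH card_GP (ip_iso bf ef) {f bf ef}.
case: gE => -> ce.
  by rewrite ip_GP3 //; have -> : e = (k + l).+1 by move: ce; clear; lia.
by rewrite ip_GP5 //; have -> : e = (k + l).+2 by move: ce; clear; lia.
Qed.

Lemma ip_cycle_graph (R : comNzRingType) N (x : R) :
  ip [set: cycle_graph N.+3] x = pathv x N.+3 + x * pathv x N.+1.
Proof.
apply: (@ip_cycle (cycle_graph N.+3) R (fun i : 'I_N.+3 => i : nat) N x).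
- by rewrite card_ord.
- by move=> v; apply: ltn_ord.
- exact: val_inj.
move=> u v; rewrite /edge /= /sym_irrefl_closure -!val_eqE /=.
case: (eqVneq (val u) (val v)) => //= ->.
have lt := ltn_ord (v : 'I_N.+3); rewrite orbb; apply/esym/negbTE.
move: lt; rewrite leq_eqVlt ltnS => /orP[|h].
  by rewrite eqSS => /eqP ->; rewrite modnn.
by rewrite modn_small // neq_ltn ltnSn.
Qed.

(** For nonpositive [x] this gives [0 < 1 + x], on which the substitution [x / (1 + x)] depends. *)
Lemma hpos_edge (R : realFieldType) (G : sgraph) (u v : G) (x : R) :
  edge u v -> hpos [set: G] x -> 0 < 1 + x + x.
Proof.
move=> e /(_ [set u; v] (subsetT _)).
have uv : u != v by apply: contraTneq e => ->; rewrite edgexx.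
rewrite (@ip_del _ _ _ u) ?inE ?eqxx //.
have -> : [set u; v] :\ u = [set v].
  by apply/setP => z; rewrite !inE; case: eqP => //= ->; rewrite (negPf uv).
have -> : [set u; v] :\: cN u = set0.
  apply/setP => z; rewrite !inE; case: eqP => //= _.
  by case: eqP => [->|]; rewrite ?e ?andbF.
by rewrite ip1 ip0 mulr1.
Qed.

Lemma reduces_bound (R : realType) (G : sgraph) (x : R) e (F : {set G}) :
  x <= 0 -> 0 < 1 + x -> reduces R e F ->
  (forall t, x <= t -> t <= 0 -> 0 < ip [set: G] t) ->
  ip [set: G] x <= (1 + x) ^+ e * pathv (x / (1 + x)) e.+2.
Proof.
move=> x0 x1 [_ cF connF redF] posG.
rewrite redF ?gt_eqF //; apply: ler_wpM2l; first by rewrite exprn_ge0 // ltW.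
have y0 : x / (1 + x) <= 0 by rewrite mulr_le0_ge0 // invr_ge0 ltW.
rewrite -cF; apply: conn_ip_le_pathv => //; first by rewrite -card_gt0 cF.
apply: (@hpos_of_pos G R F (x / (1 + x))) => // t yt t0.
have t1 : 0 < 1 - t by rewrite subr_gt0 (le_lt_trans t0) ?ltr01.
(* Inverse of the substitution [x / (1 + x)]; it carries [[x / (1 + x), 0]] into [[x, 0]], where
   [I(G, .)] is positive. *)
pose s := t / (1 - t).
have s1 : 1 + s = (1 - t)^-1 by rewrite /s; field; rewrite gt_eqF.
have st : s / (1 + s) = t by rewrite s1 invrK /s; field; rewrite gt_eqF.
have s1p : 0 < 1 + s by rewrite s1 invr_gt0.
have s0 : s <= 0 by rewrite mulr_le0_ge0 // invr_ge0 ltW.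
have xs : x <= s.
  rewrite /s ler_pdivlMr //; move: yt; rewrite ler_pdivrMr //; lra.
have := posG s xs s0; rewrite redF ?gt_eqF // st pmulr_rgt0 //.
by rewrite exprn_gt0.
Qed.

(** For [e = 1] and [e = 2] both sides agree; for [e = 3] the difference is [- x ^+ 3], nonnegative
    since [x <= 0]. *)
Lemma le_cycle_graph (R : realFieldType) e (x : R) : x <= 0 -> 0 < 1 + x ->
  (3 <= e.*2.+1 <= 7)%N ->
  (1 + x) ^+ e * pathv (x / (1 + x)) e.+2 <= ip [set: cycle_graph e.*2.+1] x.
Proof.
move=> x0 x1; have xn : 1 + x != 0 by rewrite gt_eqF.
case: e => [|[|[|[|e]]]] // _; rewrite [_.*2.+1]/= ip_cycle_graph /=.
- by rewrite le_eqVlt; apply/orP; left; apply/eqP; field.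
- by rewrite le_eqVlt; apply/orP; left; apply/eqP; field.
- rewrite -subr_ge0; set d := (X in 0 <= X).
  have -> : d = - x * (x * x) by rewrite /d; field.
  by rewrite mulr_ge0 ?oppr_ge0 // -expr2 sqr_ge0.
Qed.

Theorem theorem3p18 (R : realType) (n : nat) (G : sgraph) :
  (3 <= n)%N -> odd n -> #|G| = n ->
  graph_connected G -> well_covered G -> unicyclic G ->
  ((n <= 7)%N -> preceq R (cycle_graph n) G) /\
  ((9 <= n)%N ->
     forall H : sgraph, #|H| = n -> in_SP H -> preceq R H G).
Proof.
move=> n3 oddn cardG cG wG uG.
have [u [v euv]] : exists u v : G, edge u v.
  have [c cc] := unicyclic_core cG uG; have [_ + _ _] := cc.
  case: c cc => // u s cc _; exists u, (next (u :: s) u).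
  by apply: (core_next cc); rewrite inE eqxx.
have gt0 (x : R) : x < 0 -> (forall t, x <= t -> t <= 0 -> 0 < ip [set: G] t) -> 0 < 1 + x.
  move=> x0 pos; have px := @hpos_of_pos G R _ x pos x (lexx _) (ltW x0).
  by have := hpos_edge euv px; lra.
have oG : odd #|G| by rewrite cardG.
have [[e [F red]]|[G7 ipG]] := well_covered_unicyclic_reduces R oG cG wG uG.
  have nE : n = e.*2.+1 by rewrite -cardG; case: red.
  split=> [n7|n9 H cH SPH]; apply: preceqI => x x0 pos; have x1 := gt0 x x0 pos;
    apply: le_trans (reduces_bound (ltW x0) x1 red pos) _.
  - by rewrite nE le_cycle_graph ?ltW // -nE n3.
  - by rewrite (in_SP_ip (e := e) SPH) ?gt_eqF // cH nE.
(* In this case [G] has the polynomial of [C_7], and [9 <= n] is impossible. *)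
rewrite -cardG G7; split=> // _; apply: preceqI => x x0 pos.
by rewrite ipG ip_cycle_graph.
Qed.
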